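(* Let $N\ge 1$ and let $\alpha,\beta,\lambda:\mathbb{R}^N\to\mathbb{R}$ be continuous functions. Assume $m>0$, $\theta>1$, $s\ge 0$, $\gamma\ge 1$, $\alpha(x)\ge 0$, $\beta(x)\ge 0$ and $\lambda(x)\ge\lambda_0$ for all $x\in\mathbb{R}^N$, where $\lambda_0>0$ is a constant. Let $p=\max\{m,\theta,2s+\gamma\}$ and let $(u,v)$, with real-valued $u,v\in L^p_{loc}(\mathbb{R}^N)$, be a distributional solution of the system $$ \begin{cases} -\Delta u+\alpha |u|^{m-1}u=-\lambda|u|^{\theta-1}u+\beta|u|^s|v|^{s+\gamma-1}v & \text{in }\mathbb{R}^N,\\ -\Delta v+\alpha |v|^{m-1}v=-\lambda|v|^{\theta-1}v+\beta|v|^s|u|^{s+\gamma-1}u & \text{in }\mathbb{R}^N. \end{cases} $$ Then $u=v$.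
   Context: A distributional solution is a pair $(u,v)$ in the stated integrability class such that both equations hold in $\mathcal{D}'(\mathbb{R}^N)$ (all terms other than the Laplacians being locally integrable functions). No sign condition is imposed on $u,v$. For $q>0$, $|t|^{q-1}t$ is understood to be $0$ at $t=0$; $|t|^s\equiv 1$ when $s=0$. Equalities between $u$ and $v$ are a.e. on $\mathbb{R}^N$. *)

(* Defs.v *)
From HB Require Import structures.
From mathcomp Require Import all_boot all_order all_algebra.
From mathcomp Require Import all_classical all_reals all_analysis.
Set Implicit Arguments.
Unset Strict Implicit.
Unset Printing Implicit Defensive.
Import Order.TTheory GRing.Theory Num.Theory.
Import numFieldNormedType.Exports.
Local Open Scope classical_set_scope.
Local Open Scope ring_scope.

(** R^n is ['rV[R]_n].  Its sigma-algebra is the one generated by the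
    coordinates (as for [n.-tuple]), i.e. the Borel sigma-algebra. *)

Section measurable_rV.
Context {R : realType}.
Variable n : nat.

Definition coord_rV (i : 'I_n) (x : 'rV[R]_n) : R := x ord0 i.

Let rV_set0 : g_sigma_preimage coord_rV set0.
Proof. exact: sigma_algebra0. Qed.

Let rV_setC A : g_sigma_preimage coord_rV A -> g_sigma_preimage coord_rV (~` A).
Proof. exact: sigma_algebraC. Qed.

Let rV_bigcup (F : _^nat) : (forall i, g_sigma_preimage coord_rV (F i)) ->
  g_sigma_preimage coord_rV (\bigcup_i (F i)).
Proof. exact: sigma_algebra_bigcup. Qed.

HB.instance Definition _ := @isMeasurable.Build default_measure_display
  'rV[R]_n (g_sigma_preimage coord_rV) rV_set0 rV_setC rV_bigcup.

End measurable_rV.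

Section measurable_fun_rV.
Context {R : realType}.

Lemma measurable_coord_rV n (i : 'I_n) :
  measurable_fun [set: 'rV[R]_n] (coord_rV i).
Proof.
move=> _ Y mY; rewrite setTI; apply: sub_sigma_algebra => /=.
rewrite -bigcup_seq/=; exists i => /=; first by rewrite mem_index_enum.
by exists Y => //; rewrite setTI.
Qed.

Lemma measurable_fun_rVP d (T : measurableType d) n (f : T -> 'rV[R]_n) :
  (forall i, measurable_fun [set: T] (coord_rV i \o f)) ->
  measurable_fun [set: T] f.
Proof.
move=> mf; suff sub : g_sigma_preimage (fun i => coord_rV i \o f) `<=` measurable.
  move=> _ A mA; apply: sub; rewrite g_sigma_preimage_comp.
  by exists A.
apply: smallest_sub; first exact: sigma_algebra_measurable.
by rewrite -bigcup_seq => A [i _ [B mB <-]]; exact: mf.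
Qed.

Definition cons_rV n (p : R * 'rV[R]_n) : 'rV[R]_n.+1 :=
  \row_j oapp (fun k => p.2 ord0 k) p.1 (unlift ord0 j).

Definition behead_rV n (x : 'rV[R]_n.+1) : 'rV[R]_n :=
  \row_k x ord0 (lift ord0 k).

Definition uncons_rV n (x : 'rV[R]_n.+1) : R * 'rV[R]_n :=
  (x ord0 ord0, behead_rV x).

Lemma cons_rVK n : cancel (@cons_rV n) (@uncons_rV n).
Proof.
case=> a x; rewrite /uncons_rV /cons_rV mxE unlift_none/=; congr pair.
by apply/rowP => k; rewrite !mxE liftK.
Qed.

Lemma measurable_cons_rV n : measurable_fun [set: R * 'rV[R]_n] (@cons_rV n).
Proof.
apply: measurable_fun_rVP => j; case: (unliftP ord0 j) => [k|] ->.
- rewrite (_ : _ \o _ = coord_rV k \o snd); last first.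
    by apply/funext => p /=; rewrite /coord_rV mxE liftK.
  by apply: measurableT_comp => //; exact: measurable_coord_rV.
- rewrite (_ : _ \o _ = fst) //.
  by apply/funext => p /=; rewrite /coord_rV mxE unlift_none.
Qed.

Lemma measurable_uncons_rV n :
  measurable_fun [set: 'rV[R]_n.+1] (@uncons_rV n).
Proof.
apply/measurable_fun_pair; first exact: measurable_coord_rV.
apply: measurable_fun_rVP => i.
rewrite (_ : _ \o _ = coord_rV (lift ord0 i)); first exact: measurable_coord_rV.
by apply/funext => x /=; rewrite /coord_rV mxE.
Qed.

End measurable_fun_rV.

Section lebesgue_rV.
Context {R : realType}.
Local Open Scope ereal_scope.

Section succ.
Variables (n : nat) (mu : {sigma_finite_measure set 'rV[R]_n -> \bar R}).

Definition lebesgue_rV_succ : set 'rV[R]_n.+1 -> \bar R :=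
  pushforward (@lebesgue_measure R \x mu) (@cons_rV R n).

Let succ0 : lebesgue_rV_succ set0 = 0.
Proof. by rewrite /lebesgue_rV_succ /pushforward preimage_set0 measure0. Qed.

Let succ_ge0 A : 0 <= lebesgue_rV_succ A.
Proof. by rewrite /lebesgue_rV_succ /pushforward; apply: measure_ge0. Qed.

Let measurable_preimage_cons A :
  measurable A -> measurable (@cons_rV R n @^-1` A).
Proof.
by move=> mA; rewrite -[X in measurable X]setTI; exact: measurable_cons_rV.
Qed.

Let succ_sigma_additive : semi_sigma_additive lebesgue_rV_succ.
Proof.
move=> F mF tF mUF; rewrite /lebesgue_rV_succ /pushforward preimage_bigcup.
apply: measure_semi_sigma_additive.
- by move=> k; exact: measurable_preimage_cons.
- apply/trivIsetP => /= i j _ _ ij; rewrite -preimage_setI.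
  by move/trivIsetP : tF => /(_ _ _ _ _ ij) ->//; rewrite preimage_set0.
- by rewrite -preimage_bigcup; exact: measurable_preimage_cons.
Qed.

HB.instance Definition _ := isMeasure.Build _ _ _ lebesgue_rV_succ
  succ0 succ_ge0 succ_sigma_additive.

Let succ_sigma_finite : sigma_finite setT lebesgue_rV_succ.
Proof.
have /sigma_finiteP[F [TF ndF Foo]] := sigma_finiteT (@lebesgue_measure R).
have /sigma_finiteP[G [TG ndG Goo]] := sigma_finiteT mu.
exists (fun k => @uncons_rV R n @^-1` (F k `*` G k)).
  rewrite -preimage_bigcup; apply/esym; rewrite -subTset => x _ /=.
  have [i _ Fi] : (\bigcup_k F k) (uncons_rV x).1 by rewrite -TF.
  have [j _ Gj] : (\bigcup_k G k) (uncons_rV x).2 by rewrite -TG.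
  exists (maxn i j) => //; split.
  - by move: Fi; exact/subsetPset/ndF/leq_maxl.
  - by move: Gj; exact/subsetPset/ndG/leq_maxr.
move=> k; have [mF Fk] := Foo k; have [mG Gk] := Goo k; split.
  rewrite -[X in measurable X]setTI; apply: measurable_uncons_rV => //.
  exact: measurableX.
rewrite /lebesgue_rV_succ /pushforward -comp_preimage.
rewrite (_ : _ \o _ = id) ?preimage_id; last exact/funext/cons_rVK.
by rewrite product_measure1E// lte_mul_pinfty// ge0_fin_numE.
Qed.

HB.instance Definition _ := Measure_isSigmaFinite.Build _ _ _ lebesgue_rV_succ
  succ_sigma_finite.

End succ.

(** Lebesgue measure on R^n: the n-fold product of Lebesgue measure on R
    (see [lebesgue_rV_box]). *)
Fixpoint lebesgue_rV (n : nat) : {sigma_finite_measure set 'rV[R]_n -> \bar R} :=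
  if n is n'.+1 then lebesgue_rV_succ (lebesgue_rV n')
  else \d_(0%R : 'rV[R]_0).

End lebesgue_rV.
Arguments lebesgue_rV {R}.

Lemma lebesgue_rV_box (R : realType) n (A : 'I_n -> set R) :
  (forall i, measurable (A i)) ->
  lebesgue_rV n [set x : 'rV[R]_n | forall i, A i (x ord0 i)]
  = (\prod_(i < n) lebesgue_measure (A i))%E.
Proof.
elim: n A => [|n IH] A mA.
  rewrite big_ord0 /= diracE (_ : _ \in _ = true)//.
  by apply/mem_set => -[].
have mB : measurable [set x : 'rV[R]_n | forall i, A (lift ord0 i) (x ord0 i)].
  rewrite (_ : mkset _ = \bigcap_(i : 'I_n) (coord_rV i @^-1` A (lift ord0 i))).
    apply: fin_bigcap_measurable => // i _.
    by rewrite -[X in measurable X]setTI; exact: measurable_coord_rV.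
  by apply/seteqP; split => x /= h i; [move=> _; exact: h|exact: (h i)].
rewrite big_ord_recl -IH// -product_measure1E// /= /lebesgue_rV_succ /pushforward;
  last exact: mA.
congr (_ _); apply/seteqP; split => -[a x] /=.
- move=> h; split; first by have := h ord0; rewrite mxE unlift_none.
  by move=> i; have := h (lift ord0 i); rewrite mxE liftK.
- move=> [h1 h2] i; rewrite mxE; case: (unliftP ord0 i) => [k|] -> /=;
  by [exact: h2|].
Qed.

Section distributions.
Context {R : realType} {N : nat}.
Implicit Types (f u v phi : 'rV[R]_N -> R).

Definition partial (i : 'I_N) phi : 'rV[R]_N -> R :=
  fun x => 'D_(delta_mx ord0 i) phi x.

Definition iter_partial (s : seq 'I_N) phi := foldr partial phi s.

Definition laplacian phi : 'rV[R]_N -> R :=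
  fun x => \sum_(i < N) partial i (partial i phi) x.

Definition smooth phi := forall s : seq 'I_N,
  continuous (iter_partial s phi) /\
  forall (i : 'I_N) x, derivable (iter_partial s phi) x (delta_mx ord0 i).

Definition test_function phi :=
  smooth phi /\ compact (closure [set x | phi x != 0]).

(** The distribution defined by a locally integrable function, and the
    distributional Laplacian (defined by transposition). *)
Definition regular_distr f : ('rV[R]_N -> R) -> R :=
  fun phi => \int[lebesgue_rV N]_(x in setT) (f x * phi x).

Definition distr_laplacian (T : ('rV[R]_N -> R) -> R) : ('rV[R]_N -> R) -> R :=
  fun phi => T (laplacian phi).

Definition Lp_loc (p : R) f := measurable_fun setT f /\
  forall K : set 'rV[R]_N, compact K ->
    (\int[lebesgue_rV N]_(x in K) (`|f x| `^ p)%:E < +oo)%E.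

(** The equation
      - Delta u + alpha |u|^(m-1) u
        = - lambda |u|^(theta-1) u + beta |u|^s |v|^(s+gamma-1) v
    in the sense of distributions.  Since [0 `^ 0 = 1], [`|t| `^ 0] is 1 for
    every [t]; a product [`|t| `^ (q - 1) * t] is 0 at [t = 0]. *)
Definition distr_equation (alpha beta lambda : 'rV[R]_N -> R)
    (m theta s gamma : R) u v :=
  forall phi, test_function phi ->
    - distr_laplacian (regular_distr u) phi
    + regular_distr (fun x => alpha x * `|u x| `^ (m - 1) * u x) phi
  = - regular_distr (fun x => lambda x * `|u x| `^ (theta - 1) * u x) phi
    + regular_distr
        (fun x => beta x * `|u x| `^ s * `|v x| `^ (s + gamma - 1) * v x) phi.

Definition distr_solution (alpha beta lambda : 'rV[R]_N -> R)
    (m theta s gamma : R) u v :=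
  distr_equation alpha beta lambda m theta s gamma u v /\
  distr_equation alpha beta lambda m theta s gamma v u.

End distributions.

(* Main.v *)
From HB Require Import structures.
Require Import Defs.
From mathcomp Require Import all_boot all_order all_algebra.
From mathcomp Require Import all_classical all_reals all_analysis.
From mathcomp Require Import measurable_realfun zify ring lra.
Set Implicit Arguments.
Unset Strict Implicit.
Unset Printing Implicit Defensive.
Import Order.TTheory GRing.Theory Num.Theory.
Import numFieldNormedType.Exports.
Local Open Scope classical_set_scope.
Local Open Scope ring_scope.

(** With [w = u - v], subtracting the equations gives [Delta w = g] where
    [g >= c w ^ theta] on [{w > 0}]: the absorption terms are monotone, and the
    coupling contributes
    [beta |u|^s |v|^s (|u|^(gamma-1) u - |v|^(gamma-1) v)].

    Let [Phi] be convex, equal to [0] on [t <= 0], to [t^q] on [[0, 1]] and affine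
    beyond, with [psi = Phi'].  Kato's inequality [Delta Phi(w) >= psi(w) g] is
    obtained by mollifying [w] and replacing the Laplacian by its
    second-difference approximation: for second differences the inequality is
    pointwise convexity, and moving them to the test function is only
    translation invariance.  Bounded [psi] suffices because [w] and [g] are
    merely locally integrable.

    Take a cutoff [phi_rho = Y(x / rho) ^ (2 (K + 1))], for which
    [|Delta phi_rho|^(K+1) <= C rho^(-2(K+1)) phi_rho^K].  For [q] large,
    [Phi(t)^(K+1) <= q (psi(t) t^theta)^K] for [t >= 0]: flattening [Phi] at
    [0] lowers the effective exponent of the absorption to [1 + 1/K].  Young's
    inequality then bounds [int psi(w) w_+^theta phi_rho] by
    [C rho^(N - 2(K+1))], which tends to [0] as soon as [N < 2(K+1)].  Hence
    [u <= v] almost everywhere, and [v <= u] by symmetry. *)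

(** * Integrable functions and translations of the line *)


(** Testing with a plain cutoff and the exponent [theta] itself would leave
    [rho^(N - 2 theta / (theta - 1))], which does not tend to 0 in high dimension. This is the
    obstacle that flattening removes: the effective exponent [1 + 1/K] has conjugate [K + 1], and
    [K] may be taken as large as the dimension requires.

    All test functions come from one algebra whose members, and hence all their derivatives, are
    bounded on the whole space; the error of a second difference is then uniform in the point.
    Restricting [w] and [g] to a cube slightly larger than the support of the test function turns
    local integrability into integrability on the whole space, so that translation invariance and
    Tonelli apply with no boundary terms.

    Removing the mollification rests on continuity of translations in [L^1]. The delicate product is
    [g * psi(w)], where [g] is unbounded and only [w] is close to its mollification: [|g|] is cut at
    a level fixed first, the Lipschitz bound of [psi] serves below it and the uniform bound above
    it. *)

Section integrability.
Context d (T : measurableType d) (R : realType) (mu : {measure set T -> \bar R}).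
Implicit Types f g : T -> R.

Lemma integrable_measurable f :
  mu.-integrable setT (EFin \o f) -> measurable_fun setT f.
Proof. by move=> /measurable_int /measurable_EFinP. Qed.

Lemma integrable_dominated f g : measurable_fun setT f ->
  (forall x, `|f x| <= g x) -> mu.-integrable setT (EFin \o g) ->
  mu.-integrable setT (EFin \o f).
Proof.
move=> mf fg; apply: le_integrable => //; first exact/measurable_EFinP.
by move=> x _; rewrite /= lee_fin (le_trans (fg x))// ler_norm.
Qed.

Lemma integrable_mul_bounded f g C : mu.-integrable setT (EFin \o f) ->
  measurable_fun setT g -> (forall x, `|g x| <= C) ->
  mu.-integrable setT (EFin \o (fun x => f x * g x)).
Proof.
move=> fi mg gC; apply: (@integrable_dominated _ (fun x => C * `|f x|)).
- by apply: measurable_funM => //; exact: integrable_measurable.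
- by move=> x; rewrite normrM mulrC ler_wpM2r.
- exact: integrableZl (integrable_norm fi).
Qed.

Lemma integrable_add f g : mu.-integrable setT (EFin \o f) ->
  mu.-integrable setT (EFin \o g) ->
  mu.-integrable setT (EFin \o (fun x => f x + g x)).
Proof.
by move=> fi gi; rewrite (_ : _ \o _ = (EFin \o f) \+ (EFin \o g))%E//;
  apply: integrableD.
Qed.

Lemma integrable_sub f g : mu.-integrable setT (EFin \o f) ->
  mu.-integrable setT (EFin \o g) ->
  mu.-integrable setT (EFin \o (fun x => f x - g x)).
Proof.
by move=> fi gi; rewrite (_ : _ \o _ = (EFin \o f) \- (EFin \o g))%E//;
  apply: integrableB.
Qed.

Lemma integrable_scale f c : mu.-integrable setT (EFin \o f) ->
  mu.-integrable setT (EFin \o (fun x => c * f x)).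
Proof. by move=> fi; exact: (integrableZl measurableT c fi). Qed.

Lemma integrable_normr f : mu.-integrable setT (EFin \o f) ->
  mu.-integrable setT (EFin \o (fun x => `|f x|)).
Proof. by move=> fi; exact: integrable_norm. Qed.

Lemma EFin_Rintegral f : mu.-integrable setT (EFin \o f) ->
  (\int[mu]_x f x)%:E = (\int[mu]_x (f x)%:E)%E.
Proof. by move=> fi; rewrite fineK//; exact: integrable_fin_num. Qed.

Lemma le_Rintegral_norm f g : measurable_fun setT f ->
  (forall x, `|f x| <= g x) -> mu.-integrable setT (EFin \o g) ->
  `|\int[mu]_x f x| <= \int[mu]_x g x.
Proof.
move=> mf fg gi; have fi := @integrable_dominated f g mf fg gi.
apply: le_trans (le_normr_Rintegral measurableT fi) _.
by apply: le_Rintegral => //; exact: integrable_norm.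
Qed.

Lemma measurable_patch f D : measurable D -> measurable_fun setT f ->
  measurable_fun setT (f \_ D).
Proof. by move=> mD mf; apply: (iffLR (measurable_restrictT f mD)); exact: measurable_funTS. Qed.

Lemma EFin_patch f D : EFin \o f \_ D = (EFin \o f) \_ D.
Proof. by apply/funext => x /=; rewrite !patchE; case: ifP. Qed.

Lemma integrable_patch f D : measurable D -> mu.-integrable D (EFin \o f) ->
  mu.-integrable setT (EFin \o f \_ D).
Proof. by move=> mD fi; rewrite EFin_patch; exact: (iffLR (integrable_mkcond _ mD)). Qed.

Lemma Rintegral_cvg0 (f_ : nat -> T -> R) g :
  (forall n, measurable_fun setT (f_ n)) ->
  {ae mu, forall x, f_ ^~ x @ \oo --> (0 : R)} ->
  mu.-integrable setT (EFin \o g) -> (forall n x, `|f_ n x| <= g x) ->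
  (fun n => \int[mu]_x f_ n x) @ \oo --> (0 : R).
Proof.
move=> mf f0 gi fg.
have [] := @dominated_convergence _ _ _ mu setT measurableT
  (fun n x => (f_ n x)%:E) (fun=> 0%E) (EFin \o g).
- by move=> n; exact/measurable_EFinP.
- exact: measurable_cst.
- apply: filterS f0 => x fx _.
  by apply: cvg_EFin => //; exact: nearW.
- by [].
- by apply: aeW => x n _; rewrite /= lee_fin.
- by move=> _ _; rewrite integral0 => /fine_cvg.
Qed.

(** Stated with integrals of nonnegative functions rather than measures of sets: this form passes
    directly through iterated integrals, and the signed case follows from positive and negative
    parts. *)
Definition integral_preserving (s : T -> T) := measurable_fun setT s /\
  forall f : T -> \bar R, measurable_fun setT f -> (forall x, 0 <= f x)%E ->
  (\int[mu]_x f (s x) = \int[mu]_x f x)%E.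

Lemma integrable_preserving s f : integral_preserving s ->
  mu.-integrable setT (EFin \o f) ->
  mu.-integrable setT (EFin \o (fun x => f (s x))).
Proof.
move=> [ms sp] fi; have mf := integrable_measurable fi.
apply/integrableP; split.
  by apply/measurable_EFinP; exact: (measurableT_comp mf).
move/integrableP : fi => [_].
rewrite -(sp (fun x => `|(f x)%:E|%E))//.
by apply: measurableT_comp => //; exact/measurable_EFinP.
Qed.

Lemma Rintegral_preserving s f : integral_preserving s ->
  measurable_fun setT f -> \int[mu]_x f (s x) = \int[mu]_x f x.
Proof.
move=> [ms sp] mf; have mF : measurable_fun setT (EFin \o f).
  exact/measurable_EFinP.
rewrite /Rintegral; congr fine; rewrite integralE [RHS]integralE; congr (_ - _)%E.
- rewrite -[RHS]sp//; last exact: measurable_funepos.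
  by apply: eq_integral => x _; rewrite [in LHS]funeposE [in RHS]funeposE.
- rewrite -[RHS]sp//; last exact: measurable_funeneg.
  by apply: eq_integral => x _; rewrite [in LHS]funenegE [in RHS]funenegE.
Qed.

Lemma Rintegral_norm_triangle f g h : mu.-integrable setT (EFin \o f) ->
  mu.-integrable setT (EFin \o g) -> mu.-integrable setT (EFin \o h) ->
  \int[mu]_x `|f x - h x| <= \int[mu]_x `|f x - g x| + \int[mu]_x `|g x - h x|.
Proof.
move=> fi gi hi; rewrite -RintegralD//.
- apply: le_Rintegral => //.
  + exact/integrable_normr/integrable_sub.
  + by apply: integrable_add; exact/integrable_normr/integrable_sub.
  + by move=> x _; rewrite ler_distD.
- exact/integrable_normr/integrable_sub.
- exact/integrable_normr/integrable_sub.
Qed.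

End integrability.

Section translation1.
Context {R : realType}.
Notation mu := (@lebesgue_measure R).
Implicit Types f : R -> R.

(** By uniqueness of Lebesgue measure it suffices to compare the pushforward with length on
    half-open intervals. *)
Lemma lebesgue_measure_shift (a : R) (A : set (measurableTypeR R)) : measurable A ->
  mu A = mu ((fun x => x + a) @^-1` A).
Proof.
move=> mA.
pose s := (fun x => x + a) : measurableTypeR R -> measurableTypeR R.
have ms : measurable_fun setT s by apply: measurable_funD.
pose s_ : {mfun measurableTypeR R >-> measurableTypeR R} :=
  HB.pack s (isMeasurableFun.Build _ _ _ _ _ ms).
apply: (@lebesgue_measure_unique R (pushforward mu s_)) => // X /ocitvP[->|[[b c] /= bc ->]].
  by rewrite !measure0.
rewrite [RHS]/= /pushforward (_ : _ @^-1` _ = `]b - a, c - a]%classic); last first.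
  by apply/seteqP; split=> x; rewrite /s_ /s /= !in_itv/= ltrBlDr lerBrDr.
rewrite !lebesgue_measure_itv/= !lte_fin ltrD2r; case: ifP => // _.
by rewrite -!EFinD; congr EFin; ring.
Qed.

Lemma ge0_integral_shift (a : R) (f : R -> \bar R) : measurable_fun setT f ->
  (forall x, 0 <= f x)%E ->
  (\int[mu]_x f (x + a)%R = \int[mu]_x f x)%E.
Proof.
move=> mf f0.
pose s := (fun x => x + a) : measurableTypeR R -> measurableTypeR R.
have ms : measurable_fun setT s by apply: measurable_funD.
pose s_ : {mfun measurableTypeR R >-> measurableTypeR R} :=
  HB.pack s (isMeasurableFun.Build _ _ _ _ _ ms).
transitivity (\int[pushforward mu s_]_x f x)%E.
  by rewrite ge0_integral_pushforward.
by apply: eq_measure_integral => A mA _; rewrite [RHS](lebesgue_measure_shift a).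
Qed.

Lemma shift_preserving (a : R) : integral_preserving mu (fun x : R => x + a).
Proof. by split; [exact: measurable_funD|exact: ge0_integral_shift]. Qed.

(** An [e / 3] argument: by translation invariance the distance between the translates of [f] and
    [h] equals the distance between [f] and [h], so continuity of translations passes to [L^1]
    limits. *)
Lemma L1_shift_cvg1_approx f :
  mu.-integrable setT (EFin \o f) ->
  (forall e, 0 < e -> exists2 h, mu.-integrable setT (EFin \o h) &
     \int[mu]_x `|f x - h x| <= e /\
     forall y : nat -> R, y @ \oo --> (0 : R) ->
     (fun k => \int[mu]_x `|h (x + y k) - h x|) @ \oo --> (0 : R)) ->
  forall y : nat -> R, y @ \oo --> (0 : R) ->
  (fun k => \int[mu]_x `|f (x + y k) - f x|) @ \oo --> (0 : R).
Proof.
move=> fi H y y0; apply/cvgrPdist_le => e e0.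
have [h hi [fh hy]] := H (e / 3) ltac:(lra).
have /cvgrPdist_le /(_ (e / 3) ltac:(lra)) := hy y y0.
apply: filterS => k; rewrite !sub0r !normrN ger0_norm; last exact: Rintegral_ge0.
move=> hk; rewrite ger0_norm; last exact: Rintegral_ge0.
have sp := shift_preserving (y k).
have fsi := integrable_preserving sp fi.
have hsi := integrable_preserving sp hi.
apply: le_trans (Rintegral_norm_triangle fsi hsi fi) _.
have := Rintegral_norm_triangle hsi hi fi.
rewrite (_ : \int[mu]_x `|f (x + y k) - h (x + y k)| = \int[mu]_x `|f x - h x|); last first.
  have mfh : measurable_fun setT (fun x => `|f x - h x|).
    exact: integrable_measurable (integrable_normr (integrable_sub fi hi)).
  by have := Rintegral_preserving sp mfh.
rewrite (_ : \int[mu]_x `|h x - f x| = \int[mu]_x `|f x - h x|); last first.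
  by apply: eq_Rintegral => x _; rewrite distrC.
lra.
Qed.

(** [f] is cut to a segment, then approximated there by a continuous function extended by 0; for the
    latter, dominated convergence applies. *)
Lemma L1_shift_cvg1 f (y : nat -> R) :
  mu.-integrable setT (EFin \o f) -> y @ \oo --> (0 : R) ->
  (fun k => \int[mu]_x `|f (x + y k) - f x|) @ \oo --> (0 : R).
Proof.
move=> fi; apply: L1_shift_cvg1_approx => // e e0.
have mf := integrable_measurable fi.
pose I (M : R) := `[- M, M]%classic : set R.
have mI M : measurable (I M) by exact: measurable_itv.
have cut0 : (fun n : nat => \int[mu]_x `|f x - (f \_ (I n%:R)) x|) @ \oo --> (0 : R).
  apply: (@Rintegral_cvg0 _ _ R mu
    (fun n x => `|f x - (f \_ (I n%:R)) x|) (fun x => `|f x|)).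
  - move=> n; apply: measurableT_comp => //; apply: measurable_funB => //.
    by apply: measurable_patch => //; exact: mI.
  - apply: aeW => x /=; apply/cvgrPdist_le => r r0.
    near=> n; rewrite patchE ifT ?subrr ?normr0 ?subr0 ?normr0 ?ltW//.
    rewrite inE /I /= in_itv /= -ler_norml.
    near: n; exact: nbhs_infty_ger.
  - exact: integrable_normr.
  - by move=> n x; rewrite normr_id patchE; case: ifP => _; rewrite ?subrr ?normr0 ?subr0.
have /cvgrPdist_le /(_ (e / 2) ltac:(lra)) [n _ /(_ n (leqnn _)) ] := cut0.
rewrite sub0r normrN ger0_norm; last exact: Rintegral_ge0.
set E := I n%:R => fE.
have muE : (mu E < +oo)%E.
  by rewrite /E /I lebesgue_measure_itv/=; case: ifP => //; rewrite -EFinD ltry.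
have mE : measurable E by exact: mI.
have fiE : mu.-integrable E (EFin \o f) by exact: integrableS fi.
have [g [cg gi g0]] := approximation_continuous_integrable mE muE fiE.
have fEi : mu.-integrable setT (EFin \o f \_ E).
  by apply: integrable_patch => //; exact: integrableS fi.
have hi k : mu.-integrable setT (EFin \o g k \_ E) by exact: integrable_patch.
have [k gk] : exists k, \int[mu]_x `|(f \_ E) x - (g k \_ E) x| <= e / 2.
  move/fine_cvgP : g0 => [_ /cvgrPdist_le /(_ (e / 2) ltac:(lra))[k _ /(_ k (leqnn _))]].
  rewrite /= sub0r normrN ger0_norm; last first.
    by apply: fine_ge0; exact: integral_ge0.
  move=> gk; exists k; apply: le_trans gk.
  rewrite le_eqVlt -[X in _ == X]/(\int[mu]_(x in E) `|f x - g k x|).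
  rewrite Rintegral_mkcond; apply/orP; left; apply/eqP.
  apply: eq_Rintegral => x _; rewrite !patchE; case: ifP => // _.
  by rewrite subrr normr0.
exists (g k \_ E); first exact: hi.
split.
  by apply: le_trans (Rintegral_norm_triangle fi fEi (hi k)) _; lra.
move=> {}y y0.
(* A bound on all the shifts keeps every translate inside one segment, on which the constant [2 * C]
   dominates. *)
have [B yB] : exists B, forall j, `|y j| <= B.
  have cy : cvgn y by apply/cvg_ex; exists 0.
  have [M [_ yM]] := cvg_seq_bounded cy.
  by exists (M + 1) => j; apply: (yM (M + 1)) => //; rewrite ltrDl.
have [C gC] : exists C, forall x, `|(g k \_ E) x| <= C.
  have cE : compact E by exact: segment_compact.
  have [M [_ gM]] := compact_bounded (continuous_compact (continuous_subspaceT (cg k)) cE).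
  exists (Num.max (M + 1) 0) => x; rewrite patchE; case: ifPn => [|_].
    rewrite inE => xE; rewrite le_max; apply/orP; left.
    by apply: (gM (M + 1)); [rewrite ltrDl|exists x].
  by rewrite normr0 le_max lexx orbT.
have C0 : 0 <= C := le_trans (normr_ge0 _) (gC 0).
have B0 : 0 <= B := le_trans (normr_ge0 _) (yB 0%N).
have zE z : n%:R < `|z| -> (g k \_ E) z = 0.
  move=> nz; rewrite patchE ifF//; apply/negbTE; rewrite notin_setE /E /I /= in_itv/= -ler_norml.
  by apply/negP; rewrite -ltNge.
apply: (@Rintegral_cvg0 _ _ R mu (fun j x => `|(g k \_ E) (x + y j) - (g k \_ E) x|)
  ((fun=> 2 * C) \_ (I (n%:R + B)))).
- move=> j; apply: measurableT_comp => //; apply: measurable_funB.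
    exact: integrable_measurable (integrable_preserving (shift_preserving (y j)) (hi k)).
  exact: integrable_measurable (hi k).
(* The extension by 0 may jump at the two endpoints of the segment; pointwise convergence is claimed
   only off this null set. *)
- have : mu.-negligible [set n%:R; - n%:R].
    exists [set n%:R; - n%:R]; split => //; first exact: measurableU.
    by apply: countable_lebesgue_measure0; exact: finite_set_countable.
  apply: negligibleS => x /=; apply: contra_notP => xn.
  have {}xn : `|x| != n%:R.
    apply: contra_not_neq xn => xn.
    by case: (ger0P x) xn => _ <-; [left|right => /=; rewrite opprK].
  have yx : (fun j => x + y j) @ \oo --> x.
    by rewrite -[X in _ --> X]addr0; apply: cvgD => //; exact: cvg_cst.
  have gE z : `|z| <= n%:R -> (g k \_ E) z = g k z.
    by move=> nz; rewrite patchE ifT// inE /E /I /= in_itv/= -ler_norml.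
  apply/cvgrPdist_le => r r0; move: xn; rewrite neq_lt => /orP[xn|xn].
  - have gx : (fun j => g k (x + y j)) @ \oo --> g k x.
      by apply: cvg_comp yx _; exact: cg.
    near=> j.
    have yj : `|y j| < n%:R - `|x|.
      near: j; move/cvgrPdist_lt : y0 => /(_ (n%:R - `|x|)); rewrite subr_gt0 => /(_ xn).
      by apply: filterS => j; rewrite sub0r normrN.
    rewrite sub0r normrN normr_id !gE; last 2 first.
    + exact: ltW.
    + by have := ler_normD x (y j); lra.
    rewrite distrC; near: j; by move/cvgrPdist_le : gx; exact.
  - near=> j.
    have yj : `|y j| < `|x| - n%:R.
      near: j; move/cvgrPdist_lt : y0 => /(_ (`|x| - n%:R)); rewrite subr_gt0 => /(_ xn).
      by apply: filterS => j; rewrite sub0r normrN.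
    rewrite !zE ?subrr ?normr0 ?subr0 ?normr0 ?ltW//.
    by have := ler_normB (x + y j) (y j); rewrite addrK; lra.
- apply: integrable_patch; first exact: mI.
  have cI : compact (I (n%:R + B)) by exact: segment_compact.
  by apply: continuous_compact_integrable => //; apply: continuous_subspaceT => x; exact: cvg_cst.
- move=> j x; rewrite normr_id [leRHS]patchE; case: ifPn => xI.
    by apply: le_trans (ler_normB _ _) _; have := gC x; have := gC (x + y j); lra.
  move: xI; rewrite notin_setE /I /= in_itv/= -ler_norml => /negP; rewrite -ltNge => xB.
  rewrite !zE ?subrr ?normr0//; have := yB j; first by lra.
  have := ler_normB (x + y j) (y j); rewrite addrK; lra.
Unshelve. all: by end_near.
Qed.

End translation1.

(** * Translations of R^n *)


Section partial_shift.
Context d1 d2 (T1 : measurableType d1) (T2 : measurableType d2) (R : realType).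
Variables (m1 : {sigma_finite_measure set T1 -> \bar R}).
Variables (m2 : {sigma_finite_measure set T2 -> \bar R}).
Local Open Scope ereal_scope.

(** For almost every [x] the slice [F (., x)] is integrable, so the inner integral tends to 0, and
    it is dominated by twice the norm of the slice. The factors are abstract because the result is
    used with the line and [R^n] in both roles. *)
Lemma iterated_shift_cvg (F : T1 * T2 -> R) (s : nat -> T1 -> T1) :
  measurable_fun setT F ->
  \int[m2]_x \int[m1]_a `|F (a, x)|%:E < +oo ->
  (forall k, integral_preserving m1 (s k)) ->
  (forall g : T1 -> R, m1.-integrable setT (EFin \o g) ->
     (fun k => \int[m1]_a `|g (s k a) - g a|)%R @ \oo --> (0 : R)%R) ->
  (fun k => \int[m2]_x \int[m1]_a `|F (s k a, x) - F (a, x)|%:E) @ \oo --> 0.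
Proof.
move=> mF Fi sp H.
have mFx x : measurable_fun setT (fun a => F (a, x)).
  by apply: measurableT_comp => //; exact: measurable_pair2.
have mF1 : measurable_fun setT (fun p => `|F p|%:E).
  by apply/measurable_EFinP; exact: measurableT_comp.
pose J x := \int[m1]_a `|F (a, x)|%:E.
have J0 x : 0 <= J x by apply: integral_ge0 => a _; rewrite lee_fin.
have mJ : measurable_fun setT J.
  by apply: (measurable_fun_fubini_tonelli_G (fun p => `|F p|%:E)).
have Ji : m2.-integrable setT J.
  by apply/integrableP; split => //; under eq_integral do rewrite gee0_abs//.
have m_ k : measurable_fun setT (fun p : T1 * T2 => `|F (s k p.1, p.2) - F p|%:E).
  apply/measurable_EFinP; apply: measurableT_comp => //; apply: measurable_funB => //.
  apply: measurableT_comp => //; apply/measurable_fun_pair => //=.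
  by apply: measurableT_comp => //; exact: (sp k).1.
have bd k x : \int[m1]_a `|F (s k a, x) - F (a, x)|%:E <= J x + J x.
  have mFs : measurable_fun setT (fun a => F (s k a, x)).
    exact: (measurableT_comp (mFx x) (sp k).1).
  rewrite {1}/J -((sp k).2 (fun a => `|F (a, x)|%:E))//; last first.
    by apply/measurable_EFinP; exact: measurableT_comp.
  rewrite -ge0_integralD//; last 2 first.
    by apply/measurable_EFinP; exact: measurableT_comp.
    by apply/measurable_EFinP; exact: measurableT_comp.
  apply: ge0_le_integral => //.
  - by apply/measurable_EFinP; apply: measurableT_comp => //; exact: measurable_funB.
  - by apply: emeasurable_funD; apply/measurable_EFinP; exact: measurableT_comp.
  - by move=> a _; rewrite -EFinD lee_fin ler_normB.
have [] := @dominated_convergence _ _ _ m2 setT measurableT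
  (fun k x => \int[m1]_a `|F (s k a, x) - F (a, x)|%:E) (fun=> 0) (fun x => J x + J x).
- by move=> k; exact: (measurable_fun_fubini_tonelli_G
    (fun p : T1 * T2 => `|F (s k p.1, p.2) - F p|%:E)).
- exact: measurable_cst.
- apply: filterS (integrable_ae measurableT Ji) => x /(_ I) Jx _.
  have Fx : m1.-integrable setT (EFin \o (fun a => F (a, x))).
    apply/integrableP; split; first exact/measurable_EFinP.
    by move: Jx; rewrite ge0_fin_numE.
  have E k : \int[m1]_a `|F (s k a, x) - F (a, x)|%:E
      = (\int[m1]_a `|F (s k a, x) - F (a, x)|)%R%:E.
    rewrite EFin_Rintegral//; apply: (integrable_normr (mu := m1)).
    by apply: integrable_sub => //; exact: (integrable_preserving (sp k) Fx).
  rewrite /= (_ : (fun k => _) = EFin \o (fun k => (\int[m1]_a `|F (s k a, x) - F (a, x)|)%R)).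
    by apply: cvg_EFin; [exact: nearW|exact: (H _ Fx)].
  by apply/funext => k /=; rewrite E.
- exact: integrableD.
- apply: aeW => x k _; rewrite gee0_abs ?bd//.
  by apply: integral_ge0 => a _; rewrite lee_fin.
- by move=> _ _; rewrite integral0.
Qed.

End partial_shift.

Section lebesgue_rV_theory.
Context {R : realType}.
Notation leb := (@lebesgue_measure R).

Lemma ge0_integral_rVS n (f : 'rV[R]_n.+1 -> \bar R) : measurable_fun setT f ->
  (forall x, 0 <= f x)%E ->
  (\int[lebesgue_rV n.+1]_x f x
   = \int[lebesgue_rV n]_x \int[leb]_a f (cons_rV (a, x)))%E.
Proof.
move=> mf f0.
have mc := @measurable_cons_rV R n.
transitivity (\int[pushforward (leb \x lebesgue_rV n) (@cons_rV R n)]_x f x)%E.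
  by apply: eq_measure_integral => *.
rewrite ge0_integral_pushforward//= preimage_setT.
have H := @fubini_tonelli2 _ _ _ _ R leb (lebesgue_rV n) (f \o @cons_rV R n).
have mfc := measurableT_comp mf mc.
by have := H mfc (fun x => f0 _).
Qed.

Lemma cons_rV_eta n (y : 'rV[R]_n.+1) : y = cons_rV (uncons_rV y).
Proof.
apply/rowP => j; rewrite mxE; case: (unliftP ord0 j) => [k|] -> //=.
by rewrite mxE.
Qed.

Lemma cons_rVD n (a b : R) (x y : 'rV[R]_n) :
  cons_rV (a, x) + cons_rV (b, y) = cons_rV (a + b, x + y).
Proof.
apply/rowP => j; rewrite !mxE.
by case: (unliftP ord0 j) => [k|] _ /=; rewrite ?mxE.
Qed.

Lemma measurable_shift_rV n (y : 'rV[R]_n) : measurable_fun setT (fun x : 'rV[R]_n => x + y).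
Proof.
apply: measurable_fun_rVP => i.
rewrite (_ : _ \o _ = fun x => coord_rV i x + y ord0 i); last first.
  by apply/funext => x /=; rewrite /coord_rV mxE.
by apply: measurable_funD => //; exact: measurable_coord_rV.
Qed.

(** Induction on the dimension: the inner integral absorbs the shift of the first coordinate, the
    induction hypothesis the others. *)
Lemma shift_rV_preserving n (y : 'rV[R]_n) :
  integral_preserving (lebesgue_rV n) (fun x : 'rV[R]_n => x + y).
Proof.
split; first exact: measurable_shift_rV.
elim: n y => [|n IH] y f mf f0.
  by apply: eq_integral => x _; congr f; apply/rowP => -[].
rewrite [LHS]ge0_integral_rVS//; last first.
  exact: measurableT_comp (measurable_shift_rV y).
have E := ge0_integral_rVS mf f0; rewrite [RHS]E.
rewrite [y in LHS]cons_rV_eta /uncons_rV.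
have mfc : measurable_fun setT (f \o @cons_rV R n).
  exact: measurableT_comp (@measurable_cons_rV R n).
transitivity (\int[lebesgue_rV n]_x \int[leb]_a f (cons_rV (a, (x + behead_rV y)%R)))%E.
  apply: eq_integral => x _; under eq_integral do rewrite cons_rVD.
  rewrite [LHS](ge0_integral_shift _ (f := fun a => f (cons_rV (a, x + behead_rV y))))//.
  by apply: (measurableT_comp mfc); exact: measurable_pair2.
apply: (IH _ (fun x => \int[leb]_a f (cons_rV (a, x)))%E).
  have := @measurable_fun_fubini_tonelli_G _ _ _ _ R leb (f \o @cons_rV R n) mfc.
  by apply=> p; exact: f0.
by move=> x; apply: integral_ge0 => a _; exact: f0.
Qed.

(** Induction on the dimension. Each shift is the sum of one along the first coordinate, covered by
    the one-dimensional result, and one along the others, covered by the induction hypothesis; the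
    triangle inequality and invariance join the two. *)
Lemma L1_shift_cvg n (f : 'rV[R]_n -> R) (y : nat -> 'rV[R]_n) :
  (lebesgue_rV n).-integrable setT (EFin \o f) ->
  (forall i, (fun k => y k ord0 i) @ \oo --> (0 : R)) ->
  (fun k => \int[lebesgue_rV n]_x `|f (x + y k) - f x|) @ \oo --> (0 : R).
Proof.
elim: n f y => [|n IH] f y fi y0.
  rewrite [X in X @ _ --> _](_ : _ = fun=> 0); first exact: cvg_cst.
  apply/funext => k; under eq_Rintegral => x _.
    rewrite (_ : x + y k = x) ?subrr ?normr0; last by apply/rowP => -[].
    over.
  by rewrite Rintegral_cst// mul0r.
have mf := integrable_measurable fi.
pose F p := f (cons_rV p).
have mF : measurable_fun setT F.
  by have := measurableT_comp mf (@measurable_cons_rV R n).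
(* The factors are exchanged so that the shifted variable comes first when the last [n] coordinates
   move. *)
pose F' (p : 'rV[R]_n * R) := F (p.2, p.1).
have mF' : measurable_fun setT F'.
  have := @measurable_swap _ _ 'rV[R]_n (measurableTypeR R).
  by move=> /(measurableT_comp mF).
pose y1 k : 'rV[R]_n.+1 := cons_rV (y k ord0 ord0, 0).
pose y2 k : 'rV[R]_n.+1 := cons_rV (0, behead_rV (y k)).
have yE k : y k = y1 k + y2 k.
  by rewrite cons_rVD addr0 add0r -cons_rV_eta.
have m_ z : measurable_fun setT (fun x : 'rV[R]_n.+1 => `|f (x + z) - f x|%:E).
  apply/measurable_EFinP; apply: measurableT_comp => //; apply: measurable_funB => //.
  exact: measurableT_comp mf (measurable_shift_rV z).
have I1 z : (\int[lebesgue_rV n.+1]_x `|f (x + z) - f x|%:E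
   = \int[lebesgue_rV n]_x \int[leb]_a `|f (cons_rV (a, x) + z) - F (a, x)|%:E)%E.
  by rewrite (ge0_integral_rVS (m_ z)).
have Ffin : (\int[lebesgue_rV n]_x \int[leb]_a `|F (a, x)|%:E < +oo)%E.
  move/integrableP : fi => [_].
  rewrite (ge0_integral_rVS (f := fun x => `|(f x)%:E|%E))//.
  by apply: measurableT_comp => //; exact/measurable_EFinP.
have A0 : (fun k => \int[lebesgue_rV n.+1]_x `|f (x + y1 k) - f x|%:E)%E @ \oo --> 0%E.
  have := @iterated_shift_cvg _ _ _ _ R leb (lebesgue_rV n) F
    (fun k a => a + y k ord0 ord0) mF Ffin
    (fun k => shift_preserving (y k ord0 ord0)) (fun g gi => L1_shift_cvg1 gi (y0 ord0)).
  apply: cvg_trans; apply: near_eq_cvg; apply: nearW => k /=; rewrite I1.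
  by apply: eq_integral => x _; apply: eq_integral => a _; rewrite cons_rVD addr0.
have B0 : (fun k => \int[lebesgue_rV n.+1]_x `|f (x + y2 k) - f x|%:E)%E @ \oo --> 0%E.
  have := @iterated_shift_cvg _ _ _ _ R (lebesgue_rV n) leb F'
    (fun k x => x + behead_rV (y k)) mF'.
  have Tn (G : R * 'rV[R]_n -> R) : measurable_fun setT G ->
      (\int[leb]_a \int[lebesgue_rV n]_x `|G (a, x)|%:E
       = \int[lebesgue_rV n]_x \int[leb]_a `|G (a, x)|%:E)%E.
    move=> mG; have mG1 : measurable_fun setT (fun p => `|G p|%:E).
      by apply/measurable_EFinP; exact: measurableT_comp.
    by have := @fubini_tonelli _ _ _ _ R leb (lebesgue_rV n) (fun p => `|G p|%:E) mG1; exact.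
  rewrite -Tn// in Ffin; move=> /(_ Ffin (fun k => shift_rV_preserving (behead_rV (y k)))).
  have yb k : (fun j => behead_rV (y j) ord0 k) @ \oo --> (0 : R).
    by under eq_fun do rewrite mxE; exact: y0.
  move=> /(_ (fun g gi => IH g (fun j => behead_rV (y j)) gi yb)).
  apply: cvg_trans; apply: near_eq_cvg; apply: nearW => k /=; rewrite I1.
  have mk : measurable_fun setT (fun p : R * 'rV[R]_n => f (cons_rV p + y2 k) - F p).
    apply: measurable_funB => //.
    have := measurableT_comp mf (measurableT_comp (measurable_shift_rV (y2 k)) (@measurable_cons_rV R n)).
    by [].
  rewrite -(Tn _ mk).
  by apply: eq_integral => x _; apply: eq_integral => a _; rewrite cons_rVD addr0.
have fsi z : (lebesgue_rV n.+1).-integrable setT (EFin \o (fun x => f (x + z))).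
  by have := integrable_preserving (shift_rV_preserving z) fi.
have dfi z : (lebesgue_rV n.+1).-integrable setT (EFin \o (fun x => `|f (x + z) - f x|)).
  by have := integrable_normr (integrable_sub (fsi z) fi).
have dE z : (\int[lebesgue_rV n.+1]_x `|f (x + z) - f x|%:E)%E
  = (\int[lebesgue_rV n.+1]_x `|f (x + z) - f x|)%:E.
  by rewrite (EFin_Rintegral (dfi z)).
move: A0; under eq_fun do rewrite dE; move=> /fine_cvg A0.
move: B0; under eq_fun do rewrite dE; move=> /fine_cvg B0.
have := cvgD A0 B0; rewrite addr0 => AB.
apply: squeeze_cvgr; [|exact: (cvg_cst 0)|exact: AB].
apply: nearW => k; apply/andP; split; first exact: Rintegral_ge0.
apply: le_trans (Rintegral_norm_triangle (fsi _) (fsi (y2 k)) fi) _.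
rewrite lerD2r le_eqVlt; apply/orP; left; apply/eqP.
rewrite -[RHS](Rintegral_preserving (shift_rV_preserving (y2 k)))//.
  by apply: eq_Rintegral => x _; rewrite yE -addrA (addrC (y2 k)).
exact: integrable_measurable (dfi _).
Qed.

End lebesgue_rV_theory.

(** * Smooth bounded functions *)


Section flat_functions.
Context {R : realType}.
Implicit Types (k : nat) (t : R).

(** [flat 0] is the classical smooth function that is flat at the origin. The negative powers are
    those produced by differentiation, so the linear span of the family is stable under
    derivatives. *)
Definition flat k t := if 0 < t then t^-1 ^+ k * expR (- t^-1) else 0.

Lemma flat_ge0 k t : 0 <= flat k t.
Proof.
rewrite /flat; case: ifP => // t0.
by rewrite mulr_ge0 ?expR_ge0// exprn_ge0// invr_ge0 ltW.
Qed.

Lemma exprn_expRN_le k t : 0 <= t -> t ^+ k * expR (- t) <= k`!%:R.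
Proof.
move=> t0; rewrite expRN -ler_pdivlMr ?invr_gt0 ?expR_gt0// invrK.
case: k => [|k].
  by rewrite expr0 fact0 mul1r -[leLHS]expR0 ler_expR.
rewrite mulrC -ler_pdivrMr ?ltr0n ?fact_gt0//.
by apply: le_trans (expR_ge1Dxn k t0); rewrite lerDr.
Qed.

Lemma flat_le k t : flat k t <= k`!%:R.
Proof.
rewrite /flat; case: ifP => t0; last exact: ler0n.
by apply: exprn_expRN_le; rewrite invr_ge0 ltW.
Qed.

(** For [t > 0], [flat k t] is [flat k.+2 t * t ^+ 2], and [flat k.+2] is bounded. The quadratic
    decay makes the difference quotient at 0 vanish. *)
Lemma flat_le_sqr k t : flat k t <= k.+2`!%:R * t ^+ 2.
Proof.
case: (ltP 0 t) => t0; last first.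
  by rewrite /flat ltNge t0 mulr_ge0// ?ler0n// sqr_ge0.
apply: le_trans (_ : flat k.+2 t * t ^+ 2 <= _).
  have tt : t^-1 ^+ 2 * t ^+ 2 = 1 by rewrite -exprMn mulVf ?expr1n ?gt_eqF.
  by rewrite /flat t0 -addn2 exprD mulrAC -(mulrA (t^-1 ^+ k)) tt mulr1.
by rewrite ler_wpM2r ?sqr_ge0// flat_le.
Qed.

Lemma is_derive_flat k t :
  is_derive t 1 (flat k) (flat k.+2 t - k%:R * flat k.+1 t).
Proof.
case: (ltgtP 0 t) => [t0|t0|<-].
- apply: (@near_eq_is_derive _ _ _ (fun t => t^-1 ^+ k * expR (- t^-1))).
    near=> x; rewrite /flat ifT//; near: x; exact: lt_nbhsr.
  have tn0 : t != 0 by rewrite gt_eqF.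
  have dI : is_derive t 1 (fun y : R => y^-1) (- t ^- 2 *: 1).
    exact: (is_deriveV (f := id)).
  have dX := is_deriveX k dI.
  have dE : is_derive t 1 (expR \o (fun y : R => - y^-1)) (expR (- t^-1) * - (- t ^- 2 *: 1)).
    by apply: is_derive1_comp; apply: is_deriveN.
  rewrite (_ : (fun t0 : R => _) =
    (((fun y : R => y^-1) ^+ k : R -> R) * (expR \o (fun y : R => - y^-1)))); last first.
    by apply/funext => y; rewrite mulrfctE exprfctE.
  apply: (is_derive_eq (is_deriveM dX dE)).
  rewrite /flat t0 /GRing.scale /= exprfctE.
  case: k {dX} => [|k]; first by rewrite !mul0r; field.
  by rewrite /= !exprS; field.
- apply: (@near_eq_is_derive _ _ _ (cst 0)).
    near=> x; rewrite /flat ifF//; apply/negbTE; rewrite -leNgt ltW//.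
    near: x; exact: lt_nbhsl.
  rewrite /flat !(ltNge 0 t) (ltW t0)/= mulr0 subr0; exact: is_derive_cst.
- rewrite /flat ltxx mulr0 subr0.
  have H : (fun h => h^-1 *: ((flat k \o shift 0) (h *: 1) - flat k 0)) @ 0^' --> (0:R).
    apply/cvgrPdist_le => e e0; near=> h.
    have h0 : h != 0 by near: h; exact: nbhs_dnbhs_neq.
    rewrite /= sub0r normrN addr0 [h *: 1]mulr1 [flat k 0]/flat ltxx subr0.
    rewrite [_ *: _]/(_ * _) normrM normfV ler_pdivrMl ?normr_gt0// ger0_norm ?flat_ge0//.
    apply: le_trans (flat_le_sqr _ _) _.
    rewrite -real_normK ?num_real// expr2 mulrA mulrC ler_wpM2l//.
    rewrite -ler_pdivlMl ?ltr0n ?fact_gt0//.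
    near: h; apply: dnbhs0_le; rewrite mulr_gt0// invr_gt0 ltr0n fact_gt0//.
  apply: DeriveDef; first by apply/cvg_ex; exists 0.
  exact/cvg_lim.
Unshelve. all: by end_near.
Qed.

End flat_functions.

Section flat_algebra.
Context {R : realType} {N : nat}.
Implicit Types (phi psi : 'rV[R]_N -> R) (i : 'I_N).

(** An algebra of smooth functions, stable under partial derivatives, all of
    whose members are bounded on the whole space. *)
Inductive flat_alg : ('rV[R]_N -> R) -> Prop :=
| flat_alg_flat k (a c : R) i : flat_alg (fun x => flat k (a * x ord0 i + c))
| flat_alg_cst (c : R) : flat_alg (fun=> c)
| flat_algD phi psi : flat_alg phi -> flat_alg psi ->
    flat_alg (fun x => phi x + psi x)
| flat_algM phi psi : flat_alg phi -> flat_alg psi ->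
    flat_alg (fun x => phi x * psi x).

Lemma flat_algX phi n : flat_alg phi -> flat_alg (fun x => phi x ^+ n).
Proof.
move=> Hphi; elim: n => [|n IH].
  by under eq_fun do rewrite expr0; exact: flat_alg_cst.
by under eq_fun do rewrite exprS; exact: flat_algM.
Qed.

Lemma flat_alg_sum (I : finType) (F : I -> 'rV[R]_N -> R) :
  (forall j, flat_alg (F j)) -> flat_alg (fun x => \sum_j F j x).
Proof.
move=> HF; elim: (index_enum I) => [|j s IH].
  by under eq_fun do rewrite big_nil; exact: flat_alg_cst.
by under eq_fun do rewrite big_cons; exact: flat_algD.
Qed.

Lemma flat_alg_prod (I : finType) (F : I -> 'rV[R]_N -> R) :
  (forall j, flat_alg (F j)) -> flat_alg (fun x => \prod_j F j x).
Proof.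
move=> HF; elim: (index_enum I) => [|j s IH].
  by under eq_fun do rewrite big_nil; exact: flat_alg_cst.
by under eq_fun do rewrite big_cons; exact: flat_algM.
Qed.

Lemma flat_alg_affine phi (b : R) (y : 'rV[R]_N) : flat_alg phi ->
  flat_alg (fun x => phi (b *: x + y)).
Proof.
elim=> [k a c i|c|f g _ IHf _ IHg|f g _ IHf _ IHg].
- rewrite (_ : (fun _ => _) =
    fun x : 'rV[R]_N => flat k ((a * b) * x ord0 i + (a * y ord0 i + c))).
    exact: flat_alg_flat.
  by apply/funext => x; rewrite !mxE; congr flat; ring.
- exact: flat_alg_cst.
- exact: flat_algD.
- exact: flat_algM.
Qed.

Lemma flat_alg_bounded phi : flat_alg phi -> exists C, forall x, `|phi x| <= C.
Proof.
elim=> [k a c i|c|f g _ [C fC] _ [D gD]|f g _ [C fC] _ [D gD]].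
- by exists k`!%:R => x; rewrite ger0_norm ?flat_ge0// flat_le.
- by exists `|c|.
- by exists (C + D) => x; apply: le_trans (ler_normD _ _) _; exact: lerD.
- by exists (C * D) => x; rewrite normrM ler_pM.
Qed.

Lemma continuous_flat k : continuous (@flat R k).
Proof.
move=> t; apply: differentiable_continuous; apply/derivable1_diffP.
exact: (@ex_derive _ _ _ _ _ _ _ (is_derive_flat k t)).
Qed.

Lemma flat_alg_measurable phi : flat_alg phi -> measurable_fun setT phi.
Proof.
elim=> [k a c i|c|f g _ IHf _ IHg|f g _ IHf _ IHg].
- have mf : measurable_fun setT (@flat R k).
    by apply: continuous_measurable_fun; exact: continuous_flat.
  have ma : measurable_fun setT (fun x : 'rV[R]_N => a * x ord0 i + c).
    apply: measurable_funD => //; apply: measurable_funM => //.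
    exact: measurable_coord_rV.
  by have := measurableT_comp mf ma.
- exact: measurable_cst.
- exact: measurable_funD.
- exact: measurable_funM.
Qed.

Lemma flat_alg_continuous phi : flat_alg phi -> continuous phi.
Proof.
elim=> [k a c i|c|f g _ IHf _ IHg|f g _ IHf _ IHg] x.
- apply: (@continuous_comp _ _ _ (fun x : 'rV[R]_N => a * x ord0 i + c) (flat k)).
    have xi : (fun x : 'rV[R]_N => x ord0 i) @ x --> x ord0 i by exact: coord_continuous.
    by have := cvgD (cvgM (cvg_cst a) xi) (cvg_cst c); apply.
  exact: continuous_flat.
- exact: cst_continuous.
- by have := cvgD (IHf x) (IHg x); apply.
- by have := cvgM (IHf x) (IHg x); apply.
Qed.

(** The two difference quotients are the same function; directional derivatives are thus computed
    with the one-variable chain rule. *)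
Lemma is_derive_line phi (x v : 'rV[R]_N) (d : R) :
  is_derive (0 : R) 1 (fun h => phi (h *: v + x)) d <-> is_derive x v phi d.
Proof.
have E : (fun h : R => h^-1 *: (((fun h => phi (h *: v + x)) \o shift (0:R)) (h *: (1:R))
    - phi ((0:R) *: v + x)))
  = (fun h => h^-1 *: ((phi \o shift x) (h *: v) - phi x)).
  by apply/funext => h /=; rewrite addr0 scale0r add0r [h *: 1]mulr1.
split=> -[ex vx]; apply: DeriveDef.
- by move: ex; rewrite /derivable E.
- by move: vx; rewrite /derive E.
- by move: ex; rewrite /derivable -E.
- by move: vx; rewrite /derive -E.
Qed.

Lemma flat_alg_derive phi i : flat_alg phi ->
  exists2 phi', flat_alg phi' & forall x, is_derive x (delta_mx ord0 i) phi (phi' x).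
Proof.
elim=> [k a c j|c|f g Hf [f' Hf' df] Hg [g' Hg' dg]|f g Hf [f' Hf' df] Hg [g' Hg' dg]].
- exists (fun x => (a * (i == j)%:R) *
    (flat k.+2 (a * x ord0 j + c) + - k%:R * flat k.+1 (a * x ord0 j + c))).
    apply: flat_algM; first exact: flat_alg_cst.
    apply: flat_algD; first exact: flat_alg_flat.
    by apply: flat_algM; [exact: flat_alg_cst|exact: flat_alg_flat].
  move=> x; apply/is_derive_line.
  rewrite (_ : (fun _ => _) = flat k \o (fun h => a * (i == j)%:R * h + (a * x ord0 j + c))); last first.
    apply/funext => h /=; rewrite !mxE eqxx /= eq_sym; congr flat.
    by ring.
  have dA : is_derive (0:R) 1 (fun h => a * (i == j)%:R * h + (a * x ord0 j + c)) (a * (i == j)%:R).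
    have := is_deriveD (is_deriveZ (a * (i == j)%:R) (is_derive_id (0:R) 1))
      (is_derive_cst (a * x ord0 j + c) (0:R) 1).
    by rewrite addr0 [_ *: 1]mulr1.
  apply: (is_derive_eq (is_derive1_comp (is_derive_flat k _) dA)).
  by rewrite mulr0 add0r; ring.
- by exists (fun=> 0); [exact: flat_alg_cst|move=> x; exact: is_derive_cst].
- exists (fun x => f' x + g' x); first exact: flat_algD.
  by move=> x; have := is_deriveD (df x) (dg x).
- exists (fun x => f x * g' x + g x * f' x).
    by apply: flat_algD; exact: flat_algM.
  by move=> x; have := is_deriveM (df x) (dg x).
Qed.

Lemma flat_alg_derivable phi x i : flat_alg phi -> derivable phi x (delta_mx ord0 i).
Proof. by move=> /(flat_alg_derive i)[phi' _ /(_ x)[]]. Qed.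

Lemma flat_alg_partial phi i : flat_alg phi -> flat_alg (partial i phi).
Proof.
move=> /(flat_alg_derive i)[phi' Hphi' d].
by rewrite (_ : partial i phi = phi')//; apply/funext => x; exact: derive_val.
Qed.

Lemma flat_alg_laplacian phi : flat_alg phi -> flat_alg (laplacian phi).
Proof. by move=> H; apply: flat_alg_sum => i; do 2 apply: flat_alg_partial. Qed.

Lemma flat_alg_smooth phi : flat_alg phi -> smooth phi.
Proof.
move=> H s; have {}H : flat_alg (iter_partial s phi).
  by elim: s => //= i s; exact: flat_alg_partial.
by split; [exact: flat_alg_continuous|move=> i x; exact: flat_alg_derivable].
Qed.

(** Cubes have an explicit product volume, and are tested one coordinate at a time. The strict
    inequality makes the region of vanishing open, so derivatives vanish there with the same [r]. *)
Definition box_supported (r : R) phi := forall (x : 'rV[R]_N) i, r < `|x ord0 i| -> phi x = 0.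

Lemma box_supported_partial r phi i : box_supported r phi ->
  box_supported r (partial i phi).
Proof.
move=> H x j rx; rewrite /partial (@near_eq_derive _ _ _ _ (cst 0)) ?derive_cst//.
have xj : (fun z : 'rV[R]_N => z ord0 j) @ x --> x ord0 j by exact: coord_continuous.
have nj : (fun z : 'rV[R]_N => `|z ord0 j|) @ x --> `|x ord0 j|.
  by have := cvg_norm xj; apply.
near=> z; apply: (H z j); near: z; exact: (nj _ (lt_nbhsr rx)).
Unshelve. all: by end_near.
Qed.

Lemma box_supported_laplacian r phi : box_supported r phi ->
  box_supported r (laplacian phi).
Proof.
move=> H x j rx; apply: big1 => i _.
by apply: (@box_supported_partial r (partial i phi) i _ x j rx); exact: box_supported_partial.
Qed.

Definition cbox (r : R) : set 'rV[R]_N := [set x | forall i, `|x ord0 i| <= r].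

Lemma cbox_compact r : compact (cbox r).
Proof.
rewrite (_ : cbox r = [set x | forall i, `[- r, r]%classic (x ord0 i)]).
  by apply: (@rV_compact R N (fun=> `[- r, r]%classic)) => i; exact: segment_compact.
by apply/seteqP; split => x /= + i => /(_ i); rewrite in_itv/= ler_norml.
Qed.

Lemma flat_alg_test phi r : flat_alg phi -> box_supported r phi -> test_function phi.
Proof.
move=> Hphi H; split; first exact: flat_alg_smooth.
apply: (@subclosed_compact _ _ (cbox r)); [exact: closed_closure|exact: cbox_compact|].
have cB : closed (cbox r).
  by apply: compact_closed; [exact: norm_hausdorff|exact: cbox_compact].
rewrite [X in _ `<=` X](iffLR (closure_id _) cB); apply: closure_subset => x /= xphi i.
by rewrite leNgt; apply/negP => ri; rewrite (H x i ri) eqxx in xphi.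
Qed.

End flat_algebra.

(** * Second differences *)


Section second_difference.
Context {R : realType}.
Implicit Types (f g : R -> R) (x y t : R).

Lemma derive_increment_le g g' (B h : R) : 0 <= h ->
  (forall x, is_derive x (1:R) g (g' x)) ->
  (forall x, 0 <= x <= h -> `|g' x| <= B) -> `|g h - g 0| <= B * h.
Proof.
move=> h0 dg gB.
have cg : {within `[0, h], continuous g}.
  apply: derivable_within_continuous => x _.
  exact: (@ex_derive _ _ _ _ _ _ _ (dg x)).
have [c c0h ->] := MVT_segment h0 (fun x _ => dg x) cg.
rewrite subr0 normrM (ger0_norm h0) ler_wpM2r//; apply: gB.
by rewrite in_itv/= in c0h.
Qed.

(** The mean value inequality is used at three levels, on [f2], [f1] and [f], each giving one factor
    [h]. The constant is not sharp; only the order matters, since division by [h ^+ 2] leaves an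
    error of order [h]. *)
Lemma second_difference f f1 f2 f3 (M t h : R) : 0 <= h ->
  (forall x, is_derive x (1:R) f (f1 x)) -> (forall x, is_derive x (1:R) f1 (f2 x)) ->
  (forall x, is_derive x (1:R) f2 (f3 x)) -> (forall x, `|f3 x| <= M) ->
  `|f (t + h) + f (t - h) - 2 * f t - h ^+ 2 * f2 t| <= 2 * M * h ^+ 3.
Proof.
move=> h0 d1 d2 d3 fM.
have shiftD g g' : (forall x, is_derive x (1:R) g (g' x)) ->
    forall x, is_derive x (1:R) (fun x => g (t + x)) (g' (t + x)).
  move=> dg x.
  have dA : is_derive x (1:R) (fun x : R => t + x) 1.
    have := is_deriveD (is_derive_cst t x (1:R)) (is_derive_id x (1:R)).
    by rewrite add0r.
  by have := @is_derive1_comp _ g (fun x => t + x) x _ _ (dg (t + x)) dA; rewrite mulr1.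
have shiftB g g' : (forall x, is_derive x (1:R) g (g' x)) ->
    forall x, is_derive x (1:R) (fun x => g (t - x)) (- g' (t - x)).
  move=> dg x.
  have dA : is_derive x (1:R) (fun x : R => t - x) (-1).
    have := is_deriveB (is_derive_cst t x (1:R)) (is_derive_id x (1:R)).
    by rewrite sub0r.
  by have := @is_derive1_comp _ g (fun x => t - x) x _ _ (dg (t - x)) dA; rewrite mulrN1.
have b2 x : 0 <= x <= h -> `|f2 (t + x) + f2 (t - x) - 2 * f2 t| <= 2 * M * h.
  move=> /andP[x0 xh].
  have e1 : `|f2 (t + x) - f2 t| <= M * x.
    have := derive_increment_le x0 (shiftD _ _ d3) (fun y _ => fM (t + y)).
    by rewrite addr0.
  have e2 : `|f2 (t - x) - f2 t| <= M * x.
    have := @derive_increment_le _ _ M x x0 (shiftB _ _ d3); rewrite subr0; apply => y _.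
    by rewrite normrN.
  have -> : f2 (t + x) + f2 (t - x) - 2 * f2 t = (f2 (t + x) - f2 t) + (f2 (t - x) - f2 t) by ring.
  apply: le_trans (ler_normD _ _) _.
  have M0 : 0 <= M := le_trans (normr_ge0 _) (fM 0).
  have : M * x <= M * h by rewrite ler_wpM2l.
  lra.
have b1 x : 0 <= x <= h -> `|f1 (t + x) - f1 (t - x) - 2 * f2 t * x| <= 2 * M * h * h.
  move=> /andP[x0 xh].
  have M0 : 0 <= M := le_trans (normr_ge0 _) (fM 0).
  have := @derive_increment_le (fun x => f1 (t + x) - f1 (t - x) - 2 * f2 t * x)
    (fun x => f2 (t + x) - (- f2 (t - x)) - 2 * f2 t) (2 * M * h) x x0.
  rewrite addr0 subr0 subrr mulr0 !subr0 => H; apply: le_trans (H _ _) _.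
  - move=> y.
    have := is_deriveB (is_deriveB (shiftD _ _ d2 y) (shiftB _ _ d2 y))
      (is_deriveZ (2 * f2 t) (is_derive_id y (1:R))).
    by rewrite [_ *: 1]mulr1.
  - by move=> y /andP[y0 yx]; rewrite opprK; apply: b2; rewrite y0/= (le_trans yx).
  - by rewrite ler_wpM2l// mulr_ge0// mulr_ge0.
have := @derive_increment_le (fun x => f (t + x) + f (t - x) - f2 t * x ^+ 2)
    (fun x => f1 (t + x) + (- f1 (t - x)) - f2 t * (2 * x)) (2 * M * h * h) h h0.
rewrite addr0 subr0 expr0n/= mulr0 subr0 => H.
have -> : f (t + h) + f (t - h) - 2 * f t - h ^+ 2 * f2 t
  = f (t + h) + f (t - h) - f2 t * h ^+ 2 - (f t + f t) by ring.
have -> : 2 * M * h ^+ 3 = 2 * M * h * h * h by ring.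
apply: H => x; last first.
  move=> xh; have := b1 x xh; rewrite (_ : f2 t * (2 * x) = 2 * f2 t * x)//; ring.
have := is_deriveB (is_deriveD (shiftD _ _ d1 x) (shiftB _ _ d1 x))
      (is_deriveZ (f2 t) (is_deriveX 2 (is_derive_id x (1:R)))).
rewrite /= expr1 [_ *: 1]mulr1 [_ *: (2 * x)](_ : _ = f2 t * (2 * x))//.
Qed.

End second_difference.

Section discrete_laplacian.
Context {R : realType} {N : nat}.
Implicit Types (phi : 'rV[R]_N -> R).
Notation e_ i := (delta_mx (ord0 : 'I_1) i : 'rV[R]_N).

Definition dlaplacian (h : R) phi (x : 'rV[R]_N) : R :=
  \sum_(i < N) (phi (x + h *: e_ i) + phi (x + (- h) *: e_ i) - 2 * phi x) / h ^+ 2.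

(** Third derivatives stay in the algebra, hence are bounded on the whole space; this is why [C]
    depends neither on [x] nor on [h]. *)
Lemma flat_alg_dlaplacian phi : flat_alg phi ->
  exists C, forall h x, 0 < h -> `|dlaplacian h phi x - laplacian phi x| <= C * h.
Proof.
move=> Hphi.
have /boolp.choice[M HM] : forall i : 'I_N, exists C, forall x,
    `|partial i (partial i (partial i phi)) x| <= C.
  by move=> i; apply: flat_alg_bounded; do 3 apply: flat_alg_partial.
exists (\sum_i 2 * M i) => h x h0.
rewrite /dlaplacian /laplacian -sumrB mulr_suml.
apply: le_trans (ler_norm_sum _ _ _) _; apply: ler_sum => i _.
have d f : flat_alg f -> forall t : R,
    is_derive t (1:R) (fun s => f (x + s *: e_ i)) (partial i f (x + t *: e_ i)).
  move=> Hf t.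
  have := derivableP (@flat_alg_derivable R N f (x + t *: e_ i) i Hf).
  move/is_derive_line => H.
  have dA : is_derive t (1:R) (fun s => s - t) 1.
    have := is_deriveB (is_derive_id t (1:R)) (is_derive_cst t t (1:R)).
    by rewrite subr0.
  rewrite -(subrr t) in H.
  have := @is_derive1_comp _ _ (fun s => s - t) t _ _ H dA; rewrite mulr1.
  congr is_derive; apply/funext => s /=.
  by congr f; rewrite scalerBl addrCA subrK addrC.
have H1 := flat_alg_partial i Hphi; have H2 := flat_alg_partial i H1.
have := second_difference 0 (ltW h0) (d _ Hphi) (d _ H1) (d _ H2)
  (fun t => HM i (x + t *: e_ i)).
rewrite add0r sub0r scale0r addr0 => H.
have h2 : 0 < h ^+ 2 by rewrite exprn_gt0.
rewrite -(ler_pM2l h2) -{1}(ger0_norm (ltW h2)) -normrM mulrBr.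
rewrite mulrCA divff ?gt_eqF// mulr1; apply: le_trans H _.
by rewrite le_eqVlt; apply/orP; left; apply/eqP; ring.
Qed.

Lemma partial_affine phi i b (y : 'rV[R]_N) : flat_alg phi ->
  partial i (fun x => phi (b *: x + y)) = fun x => b * partial i phi (b *: x + y).
Proof.
move=> Hphi; apply/funext => x.
have := derivableP (@flat_alg_derivable R N phi (b *: x + y) i Hphi).
move/is_derive_line => H.
rewrite mulrC; apply: derive_val; apply/is_derive_line.
have dA : is_derive (0:R) (1:R) (fun s => b * s) b.
  by have := is_deriveZ b (is_derive_id (0:R) (1:R)); rewrite [_ *: 1]mulr1.
rewrite -(mulr0 b) in H.
have := @is_derive1_comp _ _ (fun s => b * s) 0 _ _ H dA; congr is_derive; apply/funext => s /=.
by congr phi; rewrite scalerDr scalerA addrA.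
Qed.

Lemma laplacian_affine phi b (y x : 'rV[R]_N) : flat_alg phi ->
  laplacian (fun x => phi (b *: x + y)) x = b ^+ 2 * laplacian phi (b *: x + y).
Proof.
move=> Hphi; rewrite /laplacian mulr_sumr; apply: eq_bigr => i _.
have H1 := flat_alg_partial i Hphi.
rewrite partial_affine// /partial.
have -> : (fun x0 : 'rV[R]_N => b * 'D_(e_ i) phi (b *: x0 + y)) = b \*: (fun x => partial i phi (b *: x + y)).
  by [].
rewrite deriveZ; last by apply: flat_alg_derivable; exact: flat_alg_affine.
have := congr1 (fun g => g x) (partial_affine i b y H1); rewrite /partial => ->.
by rewrite /GRing.scale/= mulrA.
Qed.

(** The cofactor is [(n+2)(n+1) |grad phi|^2 + (n+2) phi (Delta phi)]. What counts is that it is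
    bounded, so that the Laplacian of a power is controlled by a slightly smaller power. *)
Lemma laplacian_exp phi n : flat_alg phi -> exists2 psi, flat_alg psi &
  forall x, laplacian (fun x => phi x ^+ n.+2) x = phi x ^+ n * psi x.
Proof.
move=> Hphi.
exists (fun x => \sum_i ((n.+2 * n.+1)%:R * partial i phi x ^+ 2
   + n.+2%:R * phi x * partial i (partial i phi) x)).
  apply: flat_alg_sum => i; have H1 := flat_alg_partial i Hphi.
  apply: flat_algD; apply: flat_algM.
  - exact: flat_alg_cst.
  - exact: flat_algX.
  - by apply: flat_algM => //; exact: flat_alg_cst.
  - exact: flat_alg_partial.
move=> x; rewrite /laplacian mulr_sumr; apply: eq_bigr => i _.
have dX k z f : flat_alg f ->
    is_derive z (e_ i) (fun x => f x ^+ k) (k%:R * f z ^+ k.-1 * partial i f z).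
  move=> Hf; have := is_deriveX k (derivableP (@flat_alg_derivable R N f z i Hf)).
  by congr is_derive; apply/funext => w; rewrite exprfctE.
have E : partial i (fun x => phi x ^+ n.+2)
  = (n.+2%:R \*: (fun x => phi x ^+ n.+1)) * partial i phi.
  by apply/funext => z; exact: (@derive_val _ _ _ _ _ _ _ (dX n.+2 z _ Hphi)).
rewrite E; have H1 := flat_alg_partial i Hphi.
have := is_deriveM (is_deriveZ n.+2%:R (dX n.+1 x _ Hphi)) (derivableP (@flat_alg_derivable R N _ x i H1)).
move=> D; rewrite /partial in D *; rewrite (@derive_val _ _ _ _ _ _ _ D).
rewrite /GRing.scale/= natrM exprS [_ *: (phi x * _)](_ : _ = n.+2%:R * (phi x * phi x ^+ n))//; ring.
Qed.

End discrete_laplacian.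

(** * Truncated powers *)


Section truncated_power.
Context {R : realType} (n : nat).
Implicit Types (a b s t : R).

Definition clamp t := Num.min (Num.max t 0) 1.

(** [tpow t] is [0] for [t <= 0], [t ^+ n.+2] on [[0, 1]] and affine for
    [t >= 1]; [dtpow] is its derivative. *)
Definition dtpow t := n.+2%:R * clamp t ^+ n.+1.
Definition tpow t := dtpow t * t - n.+1%:R * clamp t ^+ n.+2.

Lemma clamp_ge0 t : 0 <= clamp t.
Proof. by rewrite /clamp le_min ler01 le_max lexx orbT. Qed.

Lemma clamp_le1 t : clamp t <= 1.
Proof. by rewrite /clamp ge_min lexx orbT. Qed.

Lemma clamp_le0 t : t <= 0 -> clamp t = 0.
Proof. by move=> t0; rewrite /clamp (max_idPr t0) min_l. Qed.

Lemma clamp_id t : 0 <= t <= 1 -> clamp t = t.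
Proof. by move=> /andP[t0 t1]; rewrite /clamp (max_idPl t0) min_l. Qed.

Lemma clamp_ge1 t : 1 <= t -> clamp t = 1.
Proof. by move=> t1; rewrite /clamp max_l ?min_r// (le_trans _ t1). Qed.

Variant clamp_spec t : R -> Type :=
| ClampLe0 of t <= 0 : clamp_spec t 0
| ClampId of 0 < t & t < 1 : clamp_spec t t
| ClampGe1 of 1 <= t : clamp_spec t 1.

Lemma clampP t : clamp_spec t (clamp t).
Proof.
case: (leP t 0) => t0; first by rewrite clamp_le0//; constructor.
case: (leP 1 t) => t1; first by rewrite clamp_ge1//; constructor.
by rewrite clamp_id ?(ltW t0) ?ltW//; constructor.
Qed.

Lemma clamp_lipschitz a b : `|clamp a - clamp b| <= `|a - b|.
Proof.
have := ler_norm (a - b); have := ler_norm (b - a); rewrite distrC.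
by rewrite ler_norml; case: (clampP a) => a1 *; case: (clampP b) => b1 *; lra.
Qed.

Lemma dtpow_ge0 t : 0 <= dtpow t.
Proof. by rewrite /dtpow mulr_ge0 ?ler0n// exprn_ge0// clamp_ge0. Qed.

Lemma dtpow_le t : dtpow t <= n.+2%:R.
Proof.
by rewrite /dtpow ler_piMr ?ler0n// exprn_ile1 ?clamp_ge0 ?clamp_le1.
Qed.

Lemma dtpow_norm_le t : `|dtpow t| <= n.+2%:R.
Proof. by rewrite ger0_norm ?dtpow_ge0// dtpow_le. Qed.

Lemma expr_lipschitz k a b : 0 <= a <= 1 -> 0 <= b <= 1 ->
  `|a ^+ k - b ^+ k| <= k%:R * `|a - b|.
Proof.
move=> /andP[a0 a1] /andP[b0 b1]; elim: k => [|k IH].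
  by rewrite !expr0 subrr normr0 mul0r.
have -> : a ^+ k.+1 - b ^+ k.+1 = a * (a ^+ k - b ^+ k) + (a - b) * b ^+ k.
  by rewrite !exprS; ring.
apply: le_trans (ler_normD _ _) _; rewrite !normrM -natr1 mulrDl mul1r lerD//.
  by apply: le_trans IH; rewrite ler_piMl// ger0_norm.
by rewrite ler_piMr// ger0_norm ?exprn_ge0// exprn_ile1.
Qed.

Lemma dtpow_lipschitz a b : `|dtpow a - dtpow b| <= (n.+2 * n.+1)%:R * `|a - b|.
Proof.
rewrite /dtpow -mulrBr normrM ger0_norm ?ler0n// natrM -mulrA ler_wpM2l ?ler0n//.
apply: le_trans (expr_lipschitz _ _ _) _; rewrite ?clamp_ge0 ?clamp_le1//.
by rewrite ler_wpM2l ?ler0n// clamp_lipschitz.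
Qed.

(** The tangent inequality for [b ^+ k.+1] at [a]. The inductive step multiplies the previous one by
    [a] and adds [(b ^+ k.+1 - a ^+ k.+1) * (b - a) >= 0]. *)
Lemma young_expr k a b : 0 <= a -> 0 <= b ->
  k.+1%:R * a ^+ k * b <= b ^+ k.+1 + k%:R * a ^+ k.+1.
Proof.
move=> a0 b0; elim: k => [|k IH]; first by rewrite expr0 !mul1r mul0r addr0 expr1.
have H : 0 <= (b ^+ k.+1 - a ^+ k.+1) * (b - a).
  case: (leP a b) => ab.
    by rewrite mulr_ge0 ?subr_ge0// ler_pXn2r.
  by rewrite mulr_le0// subr_le0 ?ler_pXn2r// ltW.
have := ler_wpM2l a0 IH.
move: H; rewrite !exprS -!natr1.
set A := a ^+ k; set B := b ^+ k; set K := k%:R; lra.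
Qed.

(** The claim splits along [b = clamp b + (b - clamp b)]. The clamped part is [young_expr]; the rest
    has a sign, because [dtpow] is at its minimum or maximum wherever [clamp b] differs from [b]. *)
Lemma tpow_convex a b : tpow a + dtpow a * (b - a) <= tpow b.
Proof.
suff : (n.+1%:R * (clamp b ^+ n.+2 - clamp a ^+ n.+2)) <= (dtpow b - dtpow a) * b.
  by rewrite /tpow; lra.
have := young_expr n.+1 (clamp_ge0 a) (clamp_ge0 b).
have H : 0 <= (dtpow b - dtpow a) * (b - clamp b).
  case: (clampP b) => [b0|_ _|b1].
  - rewrite subr0 mulr_le0// subr_le0 {1}/dtpow clamp_le0// expr0n/= mulr0.
    exact: dtpow_ge0.
  - by rewrite subrr mulr0.
  - rewrite mulr_ge0 ?subr_ge0// [leRHS]/dtpow clamp_ge1// expr1n mulr1.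
    exact: dtpow_le.
move: H; rewrite /dtpow !exprS -(natr1 n.+1).
set A := clamp a ^+ n; set B := clamp b ^+ n; set K := n.+1%:R; lra.
Qed.

Lemma tpow_le0 t : t <= 0 -> tpow t = 0.
Proof. by move=> t0; rewrite /tpow /dtpow clamp_le0// !expr0n/= !mulr0 mul0r subr0. Qed.

Lemma tpow_ge0 t : 0 <= tpow t.
Proof.
have := tpow_convex 0 t; rewrite tpow_le0// /dtpow clamp_le0// expr0n/=.
by rewrite mulr0 mul0r addr0.
Qed.

Lemma tpow_lipschitz a b : `|tpow a - tpow b| <= n.+2%:R * `|a - b|.
Proof.
have H x y : tpow x - tpow y <= n.+2%:R * `|x - y|.
  have := tpow_convex x y; have : dtpow x * (x - y) <= n.+2%:R * `|x - y|.
    apply: le_trans (ler_norm _) _; rewrite normrM ler_wpM2r//.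
    exact: dtpow_norm_le.
  lra.
by rewrite ler_norml H andbT lerNl opprB distrC.
Qed.

Lemma tpow_norm_le t : `|tpow t| <= n.+2%:R * `|t|.
Proof. by have := tpow_lipschitz t 0; rewrite (tpow_le0 (lexx 0)) !subr0. Qed.

Lemma lipschitz_measurable (f : R -> R) C : (forall a b, `|f a - f b| <= C * `|a - b|) ->
  measurable_fun setT f.
Proof.
move=> fC; apply: continuous_measurable_fun => x; apply/cvgrPdist_le => e e0.
near=> y; apply: le_trans (fC _ _) _.
have C1 : 0 < `|C| + 1 by rewrite ltr_wpDl.
have : `|x - y| <= e / (`|C| + 1).
  near: y; apply: cvgr_dist_le; [exact: cvg_id|exact: divr_gt0].
rewrite ler_pdivlMr//; apply: le_trans.
rewrite mulrC ler_wpM2l//; apply: le_trans (ler_norm _) _; lra.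
Unshelve. all: by end_near.
Qed.

Lemma measurable_dtpow : measurable_fun setT dtpow.
Proof. exact: lipschitz_measurable dtpow_lipschitz. Qed.

Lemma measurable_tpow : measurable_fun setT tpow.
Proof. exact: lipschitz_measurable tpow_lipschitz. Qed.

(** Write [q] for [n.+2]. On [(0, 1]] the comparison is between [t^(q (K+1))] and
    [t^((q - 1 + theta) K)], whose exponents are ordered exactly by the first hypothesis. For
    [t > 1], [tpow t <= q t] and [dtpow t = q] leave [t^(K+1) <= t^(theta K)], the second
    hypothesis, together with the factor [q]. *)
Lemma tpow_dtpow_le (K : nat) (theta t : R) : (theta - 1) * K%:R <= n.+2%:R ->
  K.+1%:R <= theta * K%:R ->
  tpow t ^+ K.+1 <= n.+2%:R * (dtpow t * Num.max t 0 `^ theta) ^+ K.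
Proof.
move=> hq hK; case: (leP t 0) => t0.
  rewrite tpow_le0// expr0n/= mulr_ge0 ?ler0n// exprn_ge0// mulr_ge0 ?powR_ge0//.
  exact: dtpow_ge0.
have q1 : 1 <= n.+2%:R :> R by rewrite ler1n.
have powE (x : R) : (t `^ x) ^+ K = t `^ (x * K%:R).
  by rewrite -powR_mulrn ?powR_ge0// -powRrM.
case: (leP t 1) => t1.
- have -> : tpow t = t ^+ n.+2.
    by rewrite /tpow /dtpow clamp_id ?(ltW t0)// -(natr1 n.+1) !exprS; ring.
  rewrite /dtpow clamp_id ?(ltW t0)// -mulrA.
  have -> : t ^+ n.+1 * t `^ theta = t `^ (n.+1%:R + theta).
    by rewrite powRD ?(gt_eqF t0) ?implybT// powR_mulrn ?ltW.
  have -> : (t ^+ n.+2) ^+ K.+1 = t `^ (n.+2%:R * K.+1%:R).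
    by rewrite -natrM powR_mulrn ?(ltW t0)// exprM.
  apply: le_trans (_ : (t `^ (n.+1%:R + theta)) ^+ K <= _).
    rewrite powE; apply: ger_powR; first by rewrite t0.
    by move: hq; rewrite -[n.+2%:R]natr1 -[K.+1%:R]natr1; lra.
  apply: le_trans (_ : 1 * (n.+2%:R * t `^ (n.+1%:R + theta)) ^+ K <= _).
    rewrite mul1r lerXn2r ?nnegrE ?mulr_ge0 ?powR_ge0 ?ler0n//.
    by rewrite ler_peMl ?powR_ge0.
  by rewrite ler_wpM2r// exprn_ge0// mulr_ge0 ?powR_ge0 ?ler0n.
- have -> : dtpow t = n.+2%:R by rewrite /dtpow clamp_ge1 ?(ltW t1)// expr1n mulr1.
  apply: le_trans (_ : (n.+2%:R * t) ^+ K.+1 <= _).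
    rewrite lerXn2r ?nnegrE ?tpow_ge0 ?mulr_ge0 ?ler0n ?(ltW t0)//.
    by have := tpow_norm_le t; rewrite (ger0_norm (tpow_ge0 t)) (ger0_norm (ltW t0)).
  rewrite !exprMn exprS -mulrA ler_wpM2l ?ler0n// ler_wpM2l ?exprn_ge0 ?ler0n//.
  by rewrite powE -powR_mulrn ?(ltW t0)// ler_powR ?(ltW t1).
Qed.

End truncated_power.

(** * Mollification *)


Section mollification.
Context {R : realType} {N : nat}.
Notation mu := (@lebesgue_rV R N).
Notation L1 f := (mu.-integrable setT (EFin \o f)).
Implicit Types (f g rho : 'rV[R]_N -> R).

(** A correlation rather than a convolution: after a change of variables the kernel is
    [rho (z - x)], a plain translate of [rho] that can serve as a test function in [z]. *)
Definition mollify rho f (x : 'rV[R]_N) : R := \int[mu]_y (f (x + y) * rho y).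

Lemma L1_flat_alg f rho : L1 f -> flat_alg rho -> L1 (fun x => f x * rho x).
Proof.
move=> fi rhoA; have [C rC] := flat_alg_bounded rhoA.
exact: (integrable_mul_bounded fi (flat_alg_measurable rhoA) rC).
Qed.

Lemma L1_shift f y : L1 f -> L1 (fun x => f (x + y)).
Proof. by move=> fi; have := integrable_preserving (shift_rV_preserving y) fi. Qed.

Lemma L1_mollify_integrand f rho x : L1 f -> flat_alg rho ->
  L1 (fun y => f (x + y) * rho y).
Proof.
move=> fi; apply: L1_flat_alg.
by under eq_fun do rewrite addrC; exact: L1_shift.
Qed.

Lemma measurable_add_rV :
  measurable_fun setT (fun p : 'rV[R]_N * 'rV[R]_N => p.1 + p.2).
Proof.
apply: measurable_fun_rVP => i.
rewrite (_ : _ \o _ = (fun p : 'rV[R]_N * 'rV[R]_N => coord_rV i p.1 + coord_rV i p.2)); last first.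
  by apply/funext => p /=; rewrite /coord_rV mxE.
by apply: measurable_funD; apply: measurableT_comp => //; exact: measurable_coord_rV.
Qed.

Lemma mollifyE f rho x : L1 f -> flat_alg rho ->
  mollify rho f x = \int[mu]_z (f z * rho (z - x)).
Proof.
move=> fi rhoA; rewrite /mollify.
pose g z := f z * rho (z - x).
have mg : measurable_fun setT g.
  apply: measurable_funM; first exact: integrable_measurable fi.
  apply: flat_alg_measurable.
  have := @flat_alg_affine R N rho 1 (- x) rhoA.
  by under eq_fun do rewrite scale1r.
rewrite -[RHS](Rintegral_preserving (shift_rV_preserving x) mg).
by apply: eq_Rintegral => y _; rewrite /g addrK addrC.
Qed.

(** Fubini: integrating first in [x], translation invariance turns the integrand into the norm of
    [f] times [rho y]. *)
Lemma L1_mollify f rho : L1 f -> flat_alg rho -> (forall x, 0 <= rho x) ->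
  L1 rho -> L1 (mollify rho f).
Proof.
move=> fi rhoA rho0 rhoi.
pose F (p : 'rV[R]_N * 'rV[R]_N) := (f (p.1 + p.2) * rho p.2)%:E.
have mf := integrable_measurable fi.
have mF : measurable_fun setT F.
  apply/measurable_EFinP; apply: measurable_funM.
    by have := measurableT_comp mf measurable_add_rV.
  have := measurableT_comp (flat_alg_measurable rhoA) (@measurable_snd _ _ 'rV[R]_N 'rV[R]_N); apply.
have Fi : (mu \x mu)%E.-integrable setT F.
  have := @integrable21ltyP _ _ _ _ R mu mu F mF; case=> _; apply.
  have [A HA] : exists A : R, (\int[mu]_x `|f x|%:E = A%:E)%E.
    by exists (\int[mu]_x `|f x|); rewrite (EFin_Rintegral (integrable_normr fi)).
  rewrite (_ : (\int[mu]_y _)%E = \int[mu]_y (A%:E * (rho y)%:E)%E)%E; last first.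
    apply: eq_integral => y _.
    transitivity (\int[mu]_x ((rho y)%:E * `|f (x + y)|%:E))%E.
      by apply: eq_integral => x _; rewrite /F/= normrM (ger0_norm (rho0 y)) mulrC.
    rewrite ge0_integralZl_EFin//; last first.
      apply/measurable_EFinP; apply: measurableT_comp => //.
      by have := measurableT_comp mf (measurable_shift_rV y).
    rewrite ((shift_rV_preserving y).2 (fun x => `|f x|%:E)) ?HA 1?muleC//.
    by apply/measurable_EFinP; exact: measurableT_comp.
  by have := integrable_lty measurableT (integrableZl measurableT A rhoi).
have := integrable_fubini_F Fi; congr (integrable _ _ _).
apply/funext => x; rewrite /fubini_F /= /mollify EFin_Rintegral//.
exact: L1_mollify_integrand.
Qed.

(** The error is the average of [f (x + y) - f x] against the probability density [rho]; after
    Tonelli only shifts [y] in the cube of half-side [e] contribute. *)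
Lemma L1_mollify_dist f rho e d : L1 f -> flat_alg rho -> (forall x, 0 <= rho x) ->
  L1 rho -> \int[mu]_y rho y = 1 -> box_supported e rho ->
  (forall y : 'rV[R]_N, (forall i, `|y ord0 i| <= e) -> \int[mu]_x `|f (x + y) - f x| <= d) ->
  \int[mu]_x `|mollify rho f x - f x| <= d.
Proof.
move=> fi rhoA rho0 rhoi rho1 rhoe fd.
have mf := integrable_measurable fi.
pose F (p : 'rV[R]_N * 'rV[R]_N) := (`|f (p.1 + p.2) - f p.1| * rho p.2)%:E.
have F0 p : (0 <= F p)%E by rewrite /F lee_fin mulr_ge0.
have mF : measurable_fun setT F.
  apply/measurable_EFinP; apply: measurable_funM.
    apply: measurableT_comp => //; apply: measurable_funB.
      by have := measurableT_comp mf measurable_add_rV.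
    by have := measurableT_comp mf (@measurable_fst _ _ 'rV[R]_N 'rV[R]_N); apply.
  by have := measurableT_comp (flat_alg_measurable rhoA) (@measurable_snd _ _ 'rV[R]_N 'rV[R]_N); apply.
have Mi := L1_mollify fi rhoA rho0 rhoi.
rewrite -lee_fin (EFin_Rintegral (integrable_normr (integrable_sub Mi fi))).
apply: (@le_trans _ _ (\int[mu]_x \int[mu]_y F (x, y))%E).
  apply: ge0_le_integral => //.
  - by apply/measurable_EFinP; exact: integrable_measurable (integrable_normr (integrable_sub Mi fi)).
  - by have := measurable_fun_fubini_tonelli_F (m2 := mu) F mF F0.
  - move=> x _.
    have i1 := L1_mollify_integrand x fi rhoA.
    have i2 : L1 (fun y => f x * rho y) by exact: integrable_scale.
    have -> : mollify rho f x - f x = \int[mu]_y (f (x + y) * rho y - f x * rho y).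
      by rewrite (RintegralB measurableT i1 i2) (RintegralZl (f x) measurableT rhoi) rho1 mulr1.
    have i3 := integrable_sub i1 i2.
    have := le_normr_Rintegral measurableT i3.
    rewrite -lee_fin (EFin_Rintegral (integrable_normr i3)) => /le_trans; apply.
    rewrite le_eqVlt; apply/orP; left; apply/eqP; apply: eq_integral => y _.
    by rewrite /F /= -mulrBl normrM (ger0_norm (rho0 y)).
have -> : (\int[mu]_x \int[mu]_y F (x, y) = \int[mu]_y \int[mu]_x F (x, y))%E.
  by have := @fubini_tonelli _ _ _ _ R mu mu F mF F0.
apply: (@le_trans _ _ (\int[mu]_y (d%:E * (rho y)%:E))%E); last first.
  have := integralZl measurableT rhoi d.
  by rewrite /= => ->; rewrite -EFin_Rintegral// rho1 mule1.
apply: ge0_le_integral => //.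
- by move=> y _; apply: integral_ge0 => x _; exact: F0.
- by have := measurable_fun_fubini_tonelli_G (m1 := mu) F mF F0.
- apply/measurable_EFinP; apply: measurable_funM; first exact: measurable_cst.
  exact: flat_alg_measurable.
- move=> y _.
  have dyi : L1 (fun x => `|f (x + y) - f x|).
    exact: integrable_normr (integrable_sub (L1_shift y fi) fi).
  have -> : (\int[mu]_x F (x, y) = (\int[mu]_x `|f (x + y) - f x| * rho y)%:E)%E.
    by rewrite EFinM EFin_Rintegral// -(integralZr measurableT dyi (rho y)).
  rewrite -EFinM lee_fin.
  have [ye|/existsNP[i /negP]] := pselect (forall i, `|y ord0 i| <= e).
    by rewrite ler_wpM2r// fd.
  by rewrite -ltNge => /rhoe ->; rewrite !mulr0.
Qed.

End mollification.


Section mollifiers.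
Context {R : realType} {N : nat}.
Notation mu := (@lebesgue_rV R N).
Notation L1 f := (mu.-integrable setT (EFin \o f)).
Implicit Types (f g rho phi : 'rV[R]_N -> R).

Lemma measurable_cbox r : measurable (@cbox R N r).
Proof.
rewrite (_ : cbox r = \bigcap_(i : 'I_N) (coord_rV i @^-1` `[- r, r])).
  apply: fin_bigcap_measurable => // i _.
  by rewrite -[X in measurable X]setTI; exact: measurable_coord_rV.
apply/seteqP; split => x /= h i; first by move=> _; rewrite /= in_itv/= -ler_norml; exact: h.
by have := h i Logic.I; rewrite /= in_itv/= -ler_norml.
Qed.

Lemma lebesgue_cbox r : 0 <= r -> mu (cbox r) = ((2 * r) ^+ N)%:E.
Proof.
move=> r0; have := @lebesgue_rV_box R N (fun=> `[- r, r]%classic) (fun=> measurable_itv _).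
rewrite (_ : [set x | _] = cbox r); last first.
  by apply/seteqP; split => x /= + i => /(_ i); rewrite in_itv/= ler_norml.
move=> ->; rewrite lebesgue_measure_itv/= lte_fin.
have E : (if - r < r then (r%:E - (- r)%:E)%E else 0%E) = (2 * r)%:E.
  case: ltP => rr; first by rewrite -EFinB; congr EFin; ring.
  by congr EFin; lra.
by rewrite E prodEFin prodr_const card_ord.
Qed.

Lemma L1_cbox r c : L1 (fun x => c * \1_(@cbox R N r) x).
Proof.
apply: integrable_scale; apply/integrableP; split.
  apply/measurable_EFinP; apply: measurable_indic; exact: measurable_cbox.
under eq_integral do rewrite /= ger0_norm//.
rewrite integral_indic//; last exact: measurable_cbox.
have sub : cbox r `<=` @cbox R N `|r|.
  by move=> x xr i; apply: le_trans (xr i) (ler_norm _).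
rewrite setIT; apply: le_lt_trans (le_measure mu _ _ sub) _; rewrite ?inE; try exact: measurable_cbox.
by have := lebesgue_cbox (normr_ge0 r) => /= ->; rewrite ltry.
Qed.

Lemma L1_box_supported phi r : flat_alg phi -> box_supported r phi -> L1 phi.
Proof.
move=> phiA phir; have [C phiC] := flat_alg_bounded phiA.
apply: (integrable_dominated (g := fun x => C * \1_(cbox r) x)).
- exact: flat_alg_measurable.
- move=> x; rewrite indicE; case: (boolP (x \in cbox r)) => [_|].
    by rewrite mulr1.
  rewrite notin_setE => /existsNP[i /negP]; rewrite -ltNge => /phir ->.
  by rewrite normr0 mulr0.
- exact: L1_cbox.
Qed.

(** The two factors are [exp(-1/(1 + x_i))] and [exp(-1/(1 - x_i))], both nonzero only for
    [|x_i| < 1]. The coefficients 1 and -1 are kept to match the constructor [flat_alg_flat]. *)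
Definition box_bump (x : 'rV[R]_N) : R :=
  \prod_(i < N) (flat 0 (1 * x ord0 i + 1) * flat 0 (-1 * x ord0 i + 1)).

Lemma flat_alg_box_bump : flat_alg box_bump.
Proof.
by apply: flat_alg_prod => i; apply: flat_algM; exact: flat_alg_flat.
Qed.

Lemma box_bump_ge0 x : 0 <= box_bump x.
Proof. by apply: prodr_ge0 => i _; rewrite mulr_ge0// flat_ge0. Qed.

Lemma box_bump_supported : box_supported 1 box_bump.
Proof.
move=> x i xi; rewrite /box_bump (bigD1 i)//=.
suff -> : flat 0 (1 * x ord0 i + 1) * flat 0 (-1 * x ord0 i + 1) = 0 by rewrite mul0r.
move: xi; rewrite /flat lter_normr => /orP[xi|xi].
- by rewrite [X in _ * X]ifF ?mulr0//; apply/negbTE; rewrite -leNgt; lra.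
- by rewrite ifF ?mul0r//; apply/negbTE; rewrite -leNgt; lra.
Qed.

(** On the half cube [1 + x_i] and [1 - x_i] are at least [1 / 2], so each factor is at least
    [expR (-2)]. *)
Lemma box_bump_gt0 : exists2 c, 0 < c & forall x, cbox (1 / 2) x -> c <= box_bump x.
Proof.
have H t : 1 / 2 <= t -> expR (-2) <= flat 0 t.
  move=> t2; rewrite /flat ifT; last by lra.
  rewrite expr0 mul1r ler_expR lerN2 -[leRHS]invrK lef_pV2 ?posrE ?invr_gt0; lra.
exists (\prod_(i < N) (expR (-2) * expR (-2))).
  by apply: prodr_gt0 => i _; rewrite mulr_gt0 ?expR_gt0.
move=> x xb; apply: ler_prod => i _; rewrite mulr_ge0 ?expR_ge0//=.
by have := xb i; rewrite ler_norml => /andP[x1 x2]; rewrite ler_pM ?expR_ge0// H//; lra.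
Qed.

Lemma mollifier_exists e : 0 < e -> exists rho, [/\ flat_alg rho,
  forall x, 0 <= rho x, box_supported e rho, L1 rho & \int[mu]_x rho x = 1].
Proof.
move=> e0; pose b x := box_bump (e^-1 *: x + 0).
have bA : flat_alg b by apply: flat_alg_affine; exact: flat_alg_box_bump.
have be : box_supported e b.
  move=> x i xi; rewrite /b addr0; apply: (@box_bump_supported _ i).
  by rewrite mxE normrM gtr0_norm ?invr_gt0// mulrC ltr_pdivlMr// mul1r.
have bi := L1_box_supported bA be.
have [c c0 cb] := box_bump_gt0.
have Ib : 0 < \int[mu]_x b x.
  apply: (@lt_le_trans _ _ (\int[mu]_x (c * \1_(cbox (e / 2)) x))).
    rewrite RintegralZl//; last first.
      by have := L1_cbox (e / 2) 1; under eq_fun do rewrite mul1r.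
    rewrite mulr_gt0// /Rintegral integral_indic//; last exact: measurable_cbox.
    have e20 : 0 <= e / 2 by lra.
    rewrite setIT; have := lebesgue_cbox e20 => /= ->.
    by rewrite /= exprn_gt0//; lra.
  apply: le_Rintegral => //; first exact: L1_cbox.
  move=> x _; rewrite indicE; case: (boolP (x \in _)) => [|_]; last by rewrite mulr0 box_bump_ge0.
  rewrite inE mulr1 => xb; apply: cb => i; rewrite addr0 mxE normrM gtr0_norm ?invr_gt0//.
  by rewrite mulrC ler_pdivrMr// mul1r mulrC; exact: xb.
exists (fun x => (\int[mu]_x b x)^-1 * b x); split.
- by apply: flat_algM => //; exact: flat_alg_cst.
- by move=> x; rewrite mulr_ge0 ?box_bump_ge0// invr_ge0 ltW.
- by move=> x i xi; rewrite (be x i xi) mulr0.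
- exact: integrable_scale.
- by rewrite RintegralZl// mulVf// gt_eqF.
Qed.

(** Otherwise each radius [1 / (k + 1)] admits a bad shift, and these shifts form a sequence
    contradicting [L1_shift_cvg]. *)
Lemma L1_shift_uniform f d : L1 f -> 0 < d -> exists2 e, 0 < e &
  forall y : 'rV[R]_N, (forall i, `|y ord0 i| <= e) -> \int[mu]_x `|f (x + y) - f x| <= d.
Proof.
move=> fi d0; apply: contrapT => H.
have /boolp.choice[y yP] : forall k, exists y : 'rV[R]_N,
    (forall i, `|y ord0 i| <= k.+1%:R^-1) /\ d < \int[mu]_x `|f (x + y) - f x|.
  move=> k; apply: contrapT => Hk; apply: H; exists k.+1%:R^-1 => // y yk.
  by rewrite leNgt; apply/negP => dy; apply: Hk; exists y.
have y0 i : (fun k => y k ord0 i) @ \oo --> (0 : R).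
  apply/cvgrPdist_le => e e0; near=> k.
  rewrite sub0r normrN; apply: le_trans ((yP k).1 i) _.
  by apply: ltW; near: k; exact: (near_infty_natSinv_lt (PosNum e0)).
have := L1_shift_cvg fi y0 => /cvgrPdist_lt /(_ d d0) [k _ /(_ k (leqnn _))].
rewrite /= sub0r normrN ger0_norm; last exact: Rintegral_ge0.
by move=> /(lt_trans (yP k).2); rewrite ltxx.
Unshelve. all: by end_near.
Qed.

End mollifiers.

(** * Kato's inequality *)


Section kato.
Context {R : realType} {N : nat}.
Notation mu := (@lebesgue_rV R N).
Notation L1 f := (mu.-integrable setT (EFin \o f)).
Implicit Types (f g w rho phi : 'rV[R]_N -> R).

Lemma L1_sum (I : finType) (F : I -> 'rV[R]_N -> R) : (forall i, L1 (F i)) ->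
  L1 (fun x => \sum_i F i x) /\
  \int[mu]_x (\sum_i F i x) = \sum_i \int[mu]_x F i x.
Proof.
move=> Fi; elim: (index_enum I) => [|i s [IH1 IH2]].
  split.
    by under eq_fun do rewrite big_nil; have := integrable0 mu setT.
  by under eq_Rintegral do rewrite big_nil; rewrite big_nil Rintegral_cst// mul0r.
split; first by under eq_fun do rewrite big_cons; exact: integrable_add.
by under eq_Rintegral do rewrite big_cons; rewrite big_cons RintegralD// IH2.
Qed.

Lemma flat_alg_shift phi y : flat_alg phi -> flat_alg (fun x => phi (x + y)).
Proof.
by move=> /(flat_alg_affine 1 y); under eq_fun do rewrite scale1r.
Qed.

Lemma laplacian_shift phi (y x : 'rV[R]_N) : flat_alg phi ->
  laplacian (fun z => phi (z + y)) x = laplacian phi (x + y).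
Proof.
move=> phiA; have := laplacian_affine 1 y x phiA; rewrite expr1n mul1r scale1r => <-.
by under [in RHS]eq_fun do rewrite scale1r.
Qed.

Lemma flat_alg_dlap phi h : flat_alg phi -> flat_alg (dlaplacian h phi).
Proof.
move=> phiA; apply: flat_alg_sum => i; apply: flat_algM; last exact: flat_alg_cst.
apply: flat_algD; first by apply: flat_algD; exact: flat_alg_shift.
by under eq_fun do rewrite -mulNr; apply: flat_algM => //; exact: flat_alg_cst.
Qed.

Lemma L1_dlaplacian f h : L1 f -> L1 (dlaplacian h f).
Proof.
move=> fi; apply: (proj1 (L1_sum _)) => i.
under eq_fun do rewrite mulrC.
apply: integrable_scale; apply: integrable_sub; last exact: integrable_scale.
by apply: integrable_add; exact: L1_shift.
Qed.

(** A shift of [phi] becomes the opposite shift of [f], and a second difference contains both. *)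
Lemma Rintegral_dlaplacian f phi h : L1 f -> flat_alg phi ->
  \int[mu]_x (f x * dlaplacian h phi x) = \int[mu]_x (dlaplacian h f x * phi x).
Proof.
move=> fi phiA.
pose e i := (delta_mx (ord0 : 'I_1) i : 'rV[R]_N).
have pi y : L1 (fun x => f x * phi (x + y)) by apply: L1_flat_alg => //; exact: flat_alg_shift.
have ip y : L1 (fun x => f (x + y) * phi x) by apply: L1_flat_alg => //; exact: L1_shift.
have p0 : L1 (fun x => f x * phi x) by exact: L1_flat_alg.
have sw y : \int[mu]_x (f x * phi (x + y)) = \int[mu]_x (f (x - y) * phi x).
  rewrite -(Rintegral_preserving (shift_rV_preserving y) (integrable_measurable (ip (- y)))).
  by apply: eq_Rintegral => x _; rewrite addrK.
transitivity (\sum_i \int[mu]_x ((h ^+ 2)^-1 *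
    (f x * phi (x + h *: e i) + f x * phi (x + (- h) *: e i) - 2 * (f x * phi x)))).
  rewrite -(proj2 (L1_sum _)).
    by apply: eq_Rintegral => x _; rewrite mulr_sumr; apply: eq_bigr => i _; ring.
  by move=> i; apply: integrable_scale; apply: integrable_sub;
    [exact: integrable_add|exact: integrable_scale].
transitivity (\sum_i \int[mu]_x ((h ^+ 2)^-1 *
    (f (x + h *: e i) * phi x + f (x + (- h) *: e i) * phi x - 2 * (f x * phi x)))); last first.
  rewrite -(proj2 (L1_sum _)).
    by apply: eq_Rintegral => x _; rewrite mulr_suml; apply: eq_bigr => i _; ring.
  by move=> i; apply: integrable_scale; apply: integrable_sub;
    [exact: integrable_add|exact: integrable_scale].
apply: eq_bigr => i _; rewrite !RintegralZl//; last 2 first.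
  by apply: integrable_sub; [exact: integrable_add|exact: integrable_scale].
  by apply: integrable_sub; [exact: integrable_add|exact: integrable_scale].
congr (_ * _); rewrite !RintegralB//; last 4 first.
  exact: integrable_add.
  exact: integrable_scale.
  exact: integrable_add.
  exact: integrable_scale.
congr (_ - _); rewrite !RintegralD// !sw addrC.
by rewrite !scaleNr opprK.
Qed.

Section kato_smooth.
Variable n : nat.
Notation Phi := (@tpow R n).
Notation psi := (@dtpow R n).

Lemma measurable_psi w : measurable_fun setT w -> measurable_fun setT (fun x => psi (w x)).
Proof. by move=> mw; have := measurableT_comp (@measurable_dtpow R n) mw. Qed.

Lemma L1_tpow w : L1 w -> L1 (fun x => Phi (w x)).
Proof.
move=> wi; apply: (integrable_dominated (g := fun x => n.+2%:R * `|w x|)).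
- by have := measurableT_comp (@measurable_tpow R n) (integrable_measurable wi).
- by move=> x; exact: tpow_norm_le.
- exact/integrable_scale/integrable_normr.
Qed.

Lemma L1_dtpow w g : L1 g -> measurable_fun setT w -> L1 (fun x => g x * psi (w x)).
Proof.
move=> gi mw; apply: (integrable_mul_bounded (C := n.+2%:R)) => //.
  exact: measurable_psi.
by move=> x; exact: dtpow_norm_le.
Qed.

Lemma dlaplacian_tpow w h x : 0 < h ->
  psi (w x) * dlaplacian h w x <= dlaplacian h (fun x => Phi (w x)) x.
Proof.
move=> h0; rewrite mulr_sumr; apply: ler_sum => i _.
rewrite mulrA ler_wpM2r ?invr_ge0 ?exprn_ge0 ?(ltW h0)//.
set a := w (x + _); set b := w (x + _).
have := tpow_convex n (w x) a; have := tpow_convex n (w x) b; lra.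
Qed.

(** Convexity of [Phi] turns the second difference of [Phi \o w] into a
    pointwise bound, so neither differentiability of [w] nor integration by
    parts is needed. *)
Lemma kato_dlaplacian w g phi C : L1 w -> L1 g -> flat_alg phi -> L1 phi ->
  (forall x, 0 <= phi x) ->
  (forall h x, 0 < h < 1 -> phi x != 0 -> `|dlaplacian h w x - g x| <= C * h) ->
  \int[mu]_x (g x * psi (w x) * phi x) <= \int[mu]_x (Phi (w x) * laplacian phi x).
Proof.
move=> wi gi phiA phii phi0 H.
have mw := integrable_measurable wi.
have Pi := L1_tpow wi.
have [C1 HC1] := flat_alg_dlaplacian phiA.
(* [D] bounds the coefficient of [h] in the sum of two errors: replacing [g] by the second
   difference of [w], and [laplacian phi] by that of [phi]. The 1 makes it positive. *)
pose D := `|n.+2%:R * C * \int[mu]_x phi x| + `|C1 * \int[mu]_x Phi (w x)| + 1.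
have D0 : 0 < D by rewrite ltr_wpDl// addr_ge0.
apply/ler_addgt0Pr => e e0.
pose h := Num.min (1 / 2) (e / D).
have h0 : 0 < h by rewrite lt_min !divr_gt0.
have h1 : h < 1 by apply: (@le_lt_trans _ _ (1 / 2)); [rewrite ge_min lexx|lra].
have hD : h * D <= e by rewrite -ler_pdivlMr// ge_min lexx orbT.
have i1 : L1 (fun x => g x * psi (w x) * phi x).
  by apply: L1_flat_alg => //; exact: L1_dtpow.
have i2 : L1 (fun x => dlaplacian h (fun x => Phi (w x)) x * phi x).
  by apply: L1_flat_alg => //; exact: L1_dlaplacian.
have i3 : L1 (fun x => n.+2%:R * C * h * phi x) by exact: integrable_scale.
have i4 : L1 (fun x => Phi (w x) * laplacian phi x).
  by apply: L1_flat_alg => //; exact: flat_alg_laplacian.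
have i5 : L1 (fun x => C1 * h * Phi (w x)) by exact: integrable_scale.
have s1 : \int[mu]_x (g x * psi (w x) * phi x) <=
    \int[mu]_x (dlaplacian h (fun x => Phi (w x)) x * phi x) + n.+2%:R * C * h * \int[mu]_x phi x.
  rewrite -RintegralZl// -RintegralD//; apply: le_Rintegral => //.
    exact: integrable_add.
  move=> x _; rewrite -mulrDl; have [->|px] := eqVneq (phi x) 0; first by rewrite !mulr0.
  rewrite ler_wpM2r//.
  have Hx : `|dlaplacian h w x - g x| <= C * h by apply: H => //; rewrite h0.
  have p0 := dtpow_ge0 n (w x).
  have q1 : psi (w x) * (g x - dlaplacian h w x) <= n.+2%:R * (C * h).
    apply: le_trans (ler_norm _) _; rewrite normrM distrC ler_pM//.
    exact: dtpow_norm_le.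
  have := dlaplacian_tpow w x h0; lra.
have s2 : \int[mu]_x (Phi (w x) * dlaplacian h phi x) <=
    \int[mu]_x (Phi (w x) * laplacian phi x) + C1 * h * \int[mu]_x Phi (w x).
  rewrite -RintegralZl// -RintegralD//; apply: le_Rintegral => //.
  - by apply: L1_flat_alg => //; exact: flat_alg_dlap.
  - exact: integrable_add.
  move=> x _; have := HC1 h x h0; rewrite ler_norml => /andP[_ Hx].
  have := ler_wpM2l (tpow_ge0 n (w x)) Hx; lra.
rewrite (Rintegral_dlaplacian _ Pi phiA) in s2.
have : n.+2%:R * C * h * \int[mu]_x phi x + C1 * h * \int[mu]_x Phi (w x) <= h * D.
  have -> : n.+2%:R * C * h * \int[mu]_x phi x + C1 * h * \int[mu]_x Phi (w x)
    = h * (n.+2%:R * C * \int[mu]_x phi x + C1 * \int[mu]_x Phi (w x)) by ring.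
  rewrite ler_pM2l// /D.
  have := ler_norm (n.+2%:R * C * \int[mu]_x phi x); have := ler_norm (C1 * \int[mu]_x Phi (w x)).
  lra.
lra.
Qed.

Lemma dlaplacian_mollify w rho h x : L1 w -> flat_alg rho ->
  dlaplacian h (mollify rho w) x = \int[mu]_z (w z * dlaplacian h rho (z - x)).
Proof.
move=> wi rhoA; pose e i := (delta_mx (ord0 : 'I_1) i : 'rV[R]_N).
have pi y : L1 (fun z => w z * rho (z - x + y)).
  apply: L1_flat_alg => //.
  by under eq_fun do rewrite -addrA; exact: flat_alg_shift.
have p0 : L1 (fun z => w z * rho (z - x)).
  by have := pi 0; under eq_fun do rewrite addr0.
have E y : mollify rho w (x + y) = \int[mu]_z (w z * rho (z - x + - y)).
  by rewrite mollifyE//; apply: eq_Rintegral => z _; rewrite opprD addrA.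
transitivity (\sum_i \int[mu]_z ((h ^+ 2)^-1 *
    (w z * rho (z - x + (- h) *: e i) + w z * rho (z - x + h *: e i) - 2 * (w z * rho (z - x))))).
  apply: eq_bigr => i _; rewrite !E mollifyE// mulrC.
  rewrite RintegralZl//; last by apply: integrable_sub; [exact: integrable_add|exact: integrable_scale].
  rewrite RintegralB//; last 2 first.
    exact: integrable_add.
    exact: integrable_scale.
  by rewrite RintegralD// RintegralZl// !scaleNr opprK.
rewrite -(proj2 (L1_sum _)).
  by apply: eq_Rintegral => z _; rewrite mulr_sumr; apply: eq_bigr => i _; ring.
by move=> i; apply: integrable_scale; apply: integrable_sub;
  [exact: integrable_add|exact: integrable_scale].
Qed.

(** For [x] in the cube of half-side [r], the translate [rho (z - x)] lives in that of half-side
    [r + 1], so it may be inserted in the equation. Both terms then become integrals of [w] against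
    bounded kernels differing by [O(h)]. *)
Lemma mollify_dlaplacian_le w g rho r : L1 w -> L1 g ->
  (forall f, flat_alg f -> box_supported (r + 1) f ->
     \int[mu]_x (w x * laplacian f x) = \int[mu]_x (g x * f x)) ->
  flat_alg rho -> box_supported 1 rho ->
  exists C, forall h x, 0 < h -> cbox r x ->
    `|dlaplacian h (mollify rho w) x - mollify rho g x| <= C * h.
Proof.
move=> wi gi H rhoA rhob; have [C HC] := flat_alg_dlaplacian rhoA.
exists (C * \int[mu]_x `|w x|) => h x h0 xr.
have rxA := flat_alg_shift (- x) rhoA.
have lxA := flat_alg_shift (- x) (flat_alg_laplacian rhoA).
have dxA := flat_alg_shift (- x) (flat_alg_dlap h rhoA).
have -> : mollify rho g x = \int[mu]_z (w z * laplacian rho (z - x)).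
  rewrite mollifyE//; have <- : \int[mu]_z (w z * laplacian (fun z => rho (z - x)) z)
      = \int[mu]_z (g z * rho (z - x)); last first.
    by apply: eq_Rintegral => z _; rewrite (laplacian_shift _ _ rhoA).
  apply: (H (fun z => rho (z - x)) rxA) => z i zi; apply: (rhob _ i); rewrite !mxE.
  have := ler_normD (z ord0 i - x ord0 i) (x ord0 i); rewrite subrK.
  have := xr i; lra.
rewrite dlaplacian_mollify//.
have i1 : L1 (fun z => w z * dlaplacian h rho (z - x)) by exact: L1_flat_alg.
have i2 : L1 (fun z => w z * laplacian rho (z - x)) by exact: L1_flat_alg.
rewrite -RintegralB// mulrAC -RintegralZl//; last exact: integrable_normr.
apply: le_Rintegral_norm.
- exact: integrable_measurable (integrable_sub i1 i2).
- by move=> z; rewrite -mulrBr normrM mulrC ler_wpM2r// HC.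
- exact/integrable_scale/integrable_normr.
Qed.

Lemma L1_truncation g d : L1 g -> 0 < d ->
  exists k : nat, \int[mu]_x Num.max 0 (`|g x| - k%:R) <= d.
Proof.
move=> gi d0; have mg := integrable_measurable gi.
have : (fun k : nat => \int[mu]_x Num.max 0 (`|g x| - k%:R)) @ \oo --> (0:R).
  apply: (@Rintegral_cvg0 _ _ R mu (fun k x => Num.max 0 (`|g x| - k%:R)) (fun x => `|g x|)).
  - move=> k; apply: measurable_maxr; first exact: measurable_cst.
    by apply: measurable_funB; [exact: measurableT_comp|exact: measurable_cst].
  - apply: aeW => x; apply/cvgrPdist_le => e e0; near=> k.
    have gk : `|g x| <= k%:R by near: k; exact: nbhs_infty_ger.
    by rewrite max_l ?subr_le0// subrr normr0 ltW.
  - exact: integrable_normr.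
  - move=> k x; rewrite ger0_norm ?le_max ?lexx//.
    by rewrite ge_max normr_ge0/= gerBl ler0n.
move=> /cvgrPdist_le /(_ d d0) [k _ /(_ k (leqnn _))].
rewrite /= sub0r normrN => H; exists k; exact: le_trans (ler_norm _) H.
Unshelve. all: by end_near.
Qed.

(** The difference of the products is [(g0 - g1) psi(b) + g0 (psi(a) - psi(b))]. In the last term
    the part of [|g0|] below [m] meets the Lipschitz bound of [psi], the excess above [m] its
    uniform bound. Only [L^1] closeness of the mollifications is then required, and no subsequence
    converging almost everywhere. *)
Lemma kato_limit_bound (P m g0 g1 a b c : R) : 0 <= c <= P -> 0 <= m ->
  g0 * psi a * c <= g1 * psi b * c + (P * n.+2%:R * `|g1 - g0|
    + P * (m * (n.+2 * n.+1)%:R) * `|b - a| + P * (2 * n.+2%:R) * Num.max 0 (`|g0| - m)).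
Proof.
move=> /andP[c0 cP] m0.
have P0 : 0 <= P := le_trans c0 cP.
pose q : R := n.+2%:R; pose X := Num.max 0 (`|g0| - m).
have X0 : 0 <= X by rewrite le_max lexx.
have gX : `|g0| <= m + X by rewrite -lerBlDl le_max lexx orbT.
have e1 : (g0 - g1) * psi b <= q * `|g1 - g0|.
  apply: le_trans (ler_norm _) _; rewrite normrM distrC mulrC ler_wpM2r//.
  exact: dtpow_norm_le.
have e2 : g0 * (psi a - psi b) <= m * (n.+2 * n.+1)%:R * `|b - a| + 2 * q * X.
  apply: le_trans (ler_norm _) _; rewrite normrM.
  have h1 := dtpow_lipschitz n b a; rewrite distrC in h1.
  have h2 : `|psi a - psi b| <= 2 * q.
    have := dtpow_norm_le n a; have := dtpow_norm_le n b.
    have := ler_normB (psi a) (psi b); rewrite -/q; lra.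
  apply: (@le_trans _ _ ((m + X) * `|psi a - psi b|)); first by rewrite ler_wpM2r.
  rewrite mulrDl lerD//; first by rewrite -mulrA ler_wpM2l.
  by rewrite mulrC ler_wpM2r.
pose Y := m * (n.+2 * n.+1)%:R * `|b - a| + 2 * q * X; rewrite -/Y in e2.
have Y0 : 0 <= Y by rewrite addr_ge0// !mulr_ge0 ?ler0n.
have Z0 : 0 <= q * `|g1 - g0| by rewrite mulr_ge0 ?ler0n.
have -> : g0 * psi a * c = g1 * psi b * c + ((g0 - g1) * psi b + g0 * (psi a - psi b)) * c by ring.
rewrite lerD2l; apply: (@le_trans _ _ ((q * `|g1 - g0| + Y) * P)).
  apply: (@le_trans _ _ ((q * `|g1 - g0| + Y) * c)).
    by rewrite ler_wpM2r// lerD.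
  by rewrite ler_wpM2l// addr_ge0.
by rewrite /Y -/q -/X le_eqVlt; apply/orP; left; apply/eqP; ring.
Qed.

(** The order of choices matters: the truncation level [k] comes first, then the mollification
    accuracy [d], which depends on [k] through the Lipschitz term. *)
Lemma kato w g phi r : L1 w -> L1 g -> flat_alg phi -> (forall x, 0 <= phi x) ->
  box_supported r phi ->
  (forall f, flat_alg f -> box_supported (r + 1) f ->
     \int[mu]_x (w x * laplacian f x) = \int[mu]_x (g x * f x)) ->
  \int[mu]_x (g x * psi (w x) * phi x) <= \int[mu]_x (Phi (w x) * laplacian phi x).
Proof.
move=> wi gi phiA phi0 phir H.
have mw := integrable_measurable wi.
have phii := L1_box_supported phiA phir.
have [P HP] := flat_alg_bounded phiA.
have [M HM] := flat_alg_bounded (flat_alg_laplacian phiA).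
have P0 : 0 <= P := le_trans (normr_ge0 _) (HP 0).
have M0 : 0 <= M := le_trans (normr_ge0 _) (HM 0).
pose q : R := n.+2%:R; pose L : R := (n.+2 * n.+1)%:R.
have q0 : 0 <= q by rewrite ler0n.
have L0 : 0 <= L by rewrite ler0n.
apply/ler_addgt0Pr => e e0.
(* This denominator leaves the excess of [|g|] above level [k] with at most [e / 2] of the error;
   [D * d] is the other half. *)
have c0 : 0 < 2 * (P * (2 * q) + 1) by have := mulr_ge0 P0 q0; lra.
have [k Hk] := L1_truncation gi (divr_gt0 e0 c0).
pose D := P * q + P * (k%:R * L) + M * q + 1.
have D0 : 0 < D by rewrite ltr_wpDl// !addr_ge0 ?mulr_ge0.
pose d := e / (2 * D); have d0 : 0 < d by rewrite divr_gt0 ?mulr_gt0.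
have [e1 e10 He1] := L1_shift_uniform wi d0.
have [e2 e20 He2] := L1_shift_uniform gi d0.
(* The bound 1 keeps translates of the kernel inside the cube of half-side [r + 1] where the
   equation is assumed. *)
pose ep := Num.min 1 (Num.min e1 e2).
have ep0 : 0 < ep by rewrite !lt_min ltr01 e10.
have [rho [rhoA rho0 rhoe rhoi rho1]] := @mollifier_exists R N _ ep0.
have wd : \int[mu]_x `|mollify rho w x - w x| <= d.
  apply: (L1_mollify_dist wi rhoA rho0 rhoi rho1 rhoe) => y ye; apply: He1 => i.
  by apply: le_trans (ye i) _; rewrite !ge_min lexx !orbT.
have gd : \int[mu]_x `|mollify rho g x - g x| <= d.
  apply: (L1_mollify_dist gi rhoA rho0 rhoi rho1 rhoe) => y ye; apply: He2 => i.
  by apply: le_trans (ye i) _; rewrite !ge_min lexx !orbT.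
have wri := L1_mollify wi rhoA rho0 rhoi.
have gri := L1_mollify gi rhoA rho0 rhoi.
have rho1b : box_supported 1 rho.
  by move=> x i xi; apply: (rhoe x i); apply: le_lt_trans xi; rewrite ge_min lexx.
have [C HC] := mollify_dlaplacian_le wi gi H rhoA rho1b.
have K := @kato_dlaplacian (mollify rho w) (mollify rho g) phi C wri gri phiA phii phi0.
have {}K : \int[mu]_x (mollify rho g x * psi (mollify rho w x) * phi x) <=
    \int[mu]_x (Phi (mollify rho w x) * laplacian phi x).
  apply: K => h x /andP[h0 h1] px; apply: HC => // i; rewrite leNgt; apply/negP => xi.
  by rewrite (phir x i xi) eqxx in px.
have lapA := flat_alg_laplacian phiA.
have i1 : L1 (fun x => g x * psi (w x) * phi x).
  by apply: L1_flat_alg => //; exact: L1_dtpow.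
have i2 : L1 (fun x => mollify rho g x * psi (mollify rho w x) * phi x).
  by apply: L1_flat_alg => //; apply: L1_dtpow => //; exact: integrable_measurable wri.
have i3 : L1 (fun x => Phi (w x) * laplacian phi x).
  by apply: L1_flat_alg => //; exact: L1_tpow.
have i4 : L1 (fun x => Phi (mollify rho w x) * laplacian phi x).
  by apply: L1_flat_alg => //; exact: L1_tpow.
have dw : L1 (fun x => `|mollify rho w x - w x|) by exact/integrable_normr/integrable_sub.
have dg : L1 (fun x => `|mollify rho g x - g x|) by exact/integrable_normr/integrable_sub.
have tg : L1 (fun x => Num.max 0 (`|g x| - k%:R)).
  apply: (integrable_dominated (g := fun x => `|g x|)); last exact: integrable_normr.
    apply: measurable_maxr; first exact: measurable_cst.
    apply: measurable_funB; last exact: measurable_cst.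
    by apply: measurableT_comp => //; exact: integrable_measurable gi.
  move=> x; rewrite ger0_norm ?le_max ?lexx//.
  by rewrite ge_max normr_ge0/= gerBl ler0n.
have S1 : \int[mu]_x (g x * psi (w x) * phi x) <=
    \int[mu]_x (mollify rho g x * psi (mollify rho w x) * phi x) +
    (P * q * d + P * (k%:R * L) * d + P * (2 * q) * (e / (2 * (P * (2 * q) + 1)))).
  have j1 : L1 (fun x => P * q * `|mollify rho g x - g x|) by exact: integrable_scale.
  have j2 : L1 (fun x => P * (k%:R * L) * `|mollify rho w x - w x|) by exact: integrable_scale.
  have j3 : L1 (fun x => P * (2 * q) * Num.max 0 (`|g x| - k%:R)) by exact: integrable_scale.
  have j12 := integrable_add j1 j2; have j123 := integrable_add j12 j3.
  apply: (@le_trans _ _ (\int[mu]_x (mollify rho g x * psi (mollify rho w x) * phi x +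
    (P * q * `|mollify rho g x - g x| + P * (k%:R * L) * `|mollify rho w x - w x|
      + P * (2 * q) * Num.max 0 (`|g x| - k%:R))))).
    apply: le_Rintegral => //; first exact: integrable_add.
    by move=> x _; apply: kato_limit_bound; rewrite ?ler0n// phi0/= (le_trans (ler_norm _) (HP x)).
  rewrite (RintegralD measurableT i2 j123) lerD2l (RintegralD measurableT j12 j3) (RintegralD measurableT j1 j2).
  rewrite (RintegralZl _ measurableT dg) (RintegralZl _ measurableT dw) (RintegralZl _ measurableT tg).
  by rewrite !lerD// ler_wpM2l// !mulr_ge0 ?ler0n.
have S2 : \int[mu]_x (Phi (mollify rho w x) * laplacian phi x) <=
    \int[mu]_x (Phi (w x) * laplacian phi x) + M * q * d.
  have j1 : L1 (fun x => M * q * `|mollify rho w x - w x|) by exact: integrable_scale.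
  apply: (@le_trans _ _ (\int[mu]_x (Phi (w x) * laplacian phi x +
      M * q * `|mollify rho w x - w x|))).
    apply: le_Rintegral => //; first exact: integrable_add.
    move=> x _; rewrite -lerBlDl -mulrBl; apply: le_trans (ler_norm _) _.
    by rewrite normrM [leRHS](_ : _ = q * `|mollify rho w x - w x| * M) ?ler_pM ?tpow_lipschitz//; ring.
  rewrite (RintegralD measurableT i3 j1) lerD2l (RintegralZl _ measurableT dw).
  by rewrite ler_wpM2l ?mulr_ge0.
have T1 : D * d <= e / 2.
  by rewrite /d le_eqVlt; apply/orP; left; apply/eqP; field; rewrite gt_eqF.
have T2 : P * (2 * q) * (e / (2 * (P * (2 * q) + 1))) <= e / 2.
  rewrite mulrA ler_pdivrMr// (_ : e / 2 * _ = P * (2 * q) * e + e); first lra.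
  by field.
have : D * d = P * q * d + P * (k%:R * L) * d + M * q * d + d by rewrite /D; ring.
lra.
Qed.

End kato_smooth.

End kato.

(** * A Liouville property *)


Section liouville.
Context {R : realType} {N : nat}.
Notation mu := (@lebesgue_rV R N).
Notation L1 f := (mu.-integrable setT (EFin \o f)).
Implicit Types (f g w rho phi : 'rV[R]_N -> R).

(** Young's inequality without fractional powers: if [Q > d * Y], replacing [Y] by [Q / d] in the
    hypothesis and cancelling [Q ^+ K] gives [Q <= B / d ^+ K]. *)
Lemma young_root (K : nat) (Q Y B d : R) : 0 <= Q -> 0 <= Y -> 0 <= B -> 0 < d ->
  Q ^+ K.+1 <= B * Y ^+ K -> Q <= d * Y + B / d ^+ K.
Proof.
move=> Q0 Y0 B0 d0 H; have dK : 0 < d ^+ K by rewrite exprn_gt0.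
have Bd : 0 <= B / d ^+ K by rewrite divr_ge0// ltW.
case: (leP Q (d * Y)) => QY; first lra.
have Qp : 0 < Q by apply: le_lt_trans QY; rewrite mulr_ge0// ltW.
suff : Q <= B / d ^+ K by have := mulr_ge0 (ltW d0) Y0; lra.
rewrite ler_pdivlMr// -(ler_pM2l (exprn_gt0 K Qp)).
rewrite mulrA -exprSr; apply: le_trans (ler_wpM2r (ltW dK) H) _.
rewrite -mulrA -exprMn [leRHS]mulrC ler_wpM2l// lerXn2r ?nnegrE ?mulr_ge0 ?(ltW d0)//.
by rewrite mulrC ltW.
Qed.

Lemma Rintegral_cbox r a : 0 <= r ->
  \int[mu]_x (a * \1_(cbox r) x) = a * (2 * r) ^+ N.
Proof.
move=> r0; rewrite RintegralZl//; last first.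
  by have := @L1_cbox R N r 1; under eq_fun do rewrite mul1r.
congr (_ * _); rewrite /Rintegral integral_indic//; last exact: measurable_cbox.
by rewrite setIT; have := lebesgue_cbox r0 => /= ->.
Qed.

Variables (theta c : R) (w g : 'rV[R]_N -> R).
Hypothesis theta1 : 1 < theta.
Hypothesis c0 : 0 < c.
Hypothesis mw : measurable_fun setT w.
Hypothesis wL : forall r, L1 (w \_ (cbox r)).
Hypothesis gL : forall r, L1 (g \_ (cbox r)).
Hypothesis eqn : forall f r, flat_alg f -> box_supported r f ->
  \int[mu]_x (w x * laplacian f x) = \int[mu]_x (g x * f x).
Hypothesis gw : forall x, 0 < w x -> c * w x `^ theta <= g x.

(** [kato] wants functions integrable on the whole space; cutting them to the cube carrying [f] does
    not change the equation tested with [f]. *)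
Lemma localized_eqn r f : flat_alg f -> box_supported r f ->
  \int[mu]_x ((w \_ (cbox r)) x * laplacian f x)
  = \int[mu]_x ((g \_ (cbox r)) x * f x).
Proof.
move=> fA fr.
have H (h1 h2 : 'rV[R]_N -> R) : box_supported r h2 ->
    \int[mu]_x ((h1 \_ (cbox r)) x * h2 x) = \int[mu]_x (h1 x * h2 x).
  move=> h2r; apply: eq_Rintegral => x _; rewrite patchE; case: ifPn => //.
  rewrite notin_setE => /existsNP[i /negP]; rewrite -ltNge => /h2r ->.
  by rewrite !mulr0.
by rewrite !H//; [exact: eqn fA fr|exact: box_supported_laplacian].
Qed.

(** Here [l] stands for the Laplacian of the cutoff at [x]. The absorption yields [c] times the
    bracket on the left; [young_root] with [d = c / 2] spends half of it on the term in [l], and the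
    other half remains. *)
Lemma pointwise_bound (K n : nat) (phi l D : R) x :
  (theta - 1) * K%:R <= n.+2%:R -> K.+1%:R <= theta * K%:R ->
  0 <= phi -> 0 <= D -> `|l| ^+ K.+1 <= D * phi ^+ K ->
  c / 2 * (dtpow n (w x) * Num.max (w x) 0 `^ theta * phi) <=
  g x * dtpow n (w x) * phi - tpow n (w x) * l + n.+2%:R * D / (c / 2) ^+ K.
Proof.
move=> hn hK phi0 D0 hl.
pose X := dtpow n (w x) * Num.max (w x) 0 `^ theta.
have X0 : 0 <= X by rewrite mulr_ge0 ?dtpow_ge0 ?powR_ge0.
have gX : c * X <= g x * dtpow n (w x).
  rewrite /X; case: (ltP 0 (w x)) => wx.
    rewrite mulrCA mulrC ler_wpM2r ?dtpow_ge0//.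
    exact: gw.
  by rewrite /dtpow clamp_le0// expr0n/= mulr0 mul0r !mulr0.
have Q : tpow n (w x) * l <= c / 2 * (X * phi) + n.+2%:R * D / (c / 2) ^+ K.
  apply: le_trans (ler_norm _) _; apply: young_root.
  - exact: normr_ge0.
  - exact: mulr_ge0.
  - by rewrite mulr_ge0 ?ler0n.
  - by rewrite divr_gt0.
  rewrite normrM exprMn (ger0_norm (tpow_ge0 _ _)).
  have H1 := tpow_dtpow_le (w x) hn hK.
  apply: le_trans (ler_pM _ _ H1 hl) _; rewrite ?exprn_ge0 ?tpow_ge0 ?normr_ge0//.
  by rewrite le_eqVlt; apply/orP; left; apply/eqP; rewrite -/X [(X * phi) ^+ K]exprMn; ring.
have := ler_wpM2r phi0 gX; rewrite -/X; lra.
Qed.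

(** A power of the rescaled bump; [C] and [k] are chosen before [rho]. With exponent [2K + 2] the
    Laplacian is [rho^-2] times [bump^(2K)] times a bounded factor, and [(bump^(2K))^(K+1)] is
    exactly [(bump^(2K+2))^K]. *)
Lemma cutoff_exists (K : nat) : exists C, 0 <= C /\ exists2 k, 0 < k &
  forall rho : R, 0 < rho -> exists phi : 'rV[R]_N -> R, [/\ flat_alg phi,
    forall x, 0 <= phi x, box_supported rho phi,
    forall x, cbox (rho / 2) x -> k <= phi x &
    forall x, `|laplacian phi x| ^+ K.+1 <= C * rho^-1 ^+ (2 * K.+1) * phi x ^+ K].
Proof.
have [psi psiA psiE] := laplacian_exp (2 * K) (@flat_alg_box_bump R N).
have [C HC] := flat_alg_bounded psiA.
have C0 : 0 <= C := le_trans (normr_ge0 _) (HC 0).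
have [k k0 Hk] := @box_bump_gt0 R N.
exists (C ^+ K.+1); split; first exact: exprn_ge0.
exists (k ^+ (2 * K).+2); first exact: exprn_gt0.
move=> rho rho0.
pose b (x : 'rV[R]_N) := box_bump x ^+ (2 * K).+2.
have bA : flat_alg b by apply: flat_algX; exact: flat_alg_box_bump.
exists (fun x => b (rho^-1 *: x + 0)); split.
- exact: flat_alg_affine.
- by move=> x; rewrite exprn_ge0// box_bump_ge0.
- move=> x i xi; rewrite /b (@box_bump_supported _ _ _ i) ?expr0n// addr0 mxE normrM gtr0_norm ?invr_gt0//.
  by rewrite mulrC ltr_pdivlMr// mul1r.
- move=> x xr; rewrite /b lerXn2r ?nnegrE ?box_bump_ge0 ?(ltW k0)//; apply: Hk => i.
  rewrite addr0 mxE normrM gtr0_norm ?invr_gt0// mulrC ler_pdivrMr//.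
  by have := xr i; lra.
- move=> x; rewrite laplacian_affine// psiE.
  set y := _ *: x + 0; rewrite /b.
  have by0 := box_bump_ge0 y.
  have r20 : 0 <= rho^-1 ^+ 2 by rewrite exprn_ge0// invr_ge0 ltW.
  have B0 : 0 <= box_bump y ^+ (2 * K) by exact: exprn_ge0.
  have hl : `|rho^-1 ^+ 2 * (box_bump y ^+ (2 * K) * psi y)|
      <= rho^-1 ^+ 2 * (box_bump y ^+ (2 * K) * C).
    rewrite normrM (ger0_norm r20) ler_wpM2l// normrM (ger0_norm B0).
    by rewrite ler_wpM2l.
  apply: le_trans (_ : (rho^-1 ^+ 2 * (box_bump y ^+ (2 * K) * C)) ^+ K.+1 <= _).
    by rewrite lerXn2r ?nnegrE ?normr_ge0//; exact: mulr_ge0 r20 (mulr_ge0 B0 C0).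
  rewrite [(rho^-1 ^+ 2 * _) ^+ K.+1]exprMn [(_ * C) ^+ K.+1]exprMn -!exprM.
  rewrite (_ : (2 * K * K.+1 = (2 * K).+2 * K)%N); last by clear; lia.
  by rewrite le_eqVlt; apply/orP; left; apply/eqP; ring.
Qed.

Lemma liouville_cbox (n K : nat) r : 0 < r -> (N <= (2 * K).+1)%N ->
  (theta - 1) * K%:R <= n.+2%:R -> K.+1%:R <= theta * K%:R ->
  {ae mu, forall x, cbox r x -> w x <= 0}.
Proof.
move=> r0 hN hn hK.
pose X x := dtpow n (w x) * Num.max (w x) 0 `^ theta.
have X0 x : 0 <= X x by rewrite mulr_ge0 ?dtpow_ge0 ?powR_ge0.
have mX : measurable_fun setT X.
  apply: measurable_funM; first exact: measurable_psi.
  have mm : measurable_fun setT (fun x => Num.max (w x) 0).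
    by apply: measurable_maxr => //; exact: measurable_cst.
  by have := measurableT_comp (@measurable_powR R theta) mm.
(* Truncating at 1 and restricting to the cube makes [Z] integrable at once; inside the cube it is
   still positive wherever [w] is. *)
pose Z x := \1_(cbox r) x * Num.min (X x) 1.
have Z0 x : 0 <= Z x by rewrite mulr_ge0// le_min X0 ler01.
have Zi : L1 Z.
  have := @L1_cbox R N r 1; under eq_fun do rewrite mul1r.
  move=> ri.
  apply: (integrable_mul_bounded (C := 1) ri).
    by apply: measurable_minr => //; exact: measurable_cst.
  by move=> x; rewrite ger0_norm ?ge_min ?lexx ?orbT// le_min X0 ler01.
have [C [C0 [k k0 H]]] := cutoff_exists K.
have I0 : 0 <= \int[mu]_x Z x by exact: Rintegral_ge0.
suff IZ : \int[mu]_x Z x <= 0.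
  have {}IZ : (\int[mu]_x `|(Z x)%:E| = 0)%E.
    under eq_integral do rewrite gee0_abs ?lee_fin//.
    by rewrite -(EFin_Rintegral Zi); congr EFin; apply/eqP; rewrite eq_le I0 IZ.
  have mZ : measurable_fun setT (EFin \o Z) by apply/measurable_EFinP; exact: integrable_measurable Zi.
  have := iffLR (ae_eq_integral_abs mu measurableT mZ) IZ.
  apply: filterS => x /(_ I) [Zx] xr; rewrite leNgt; apply/negP => wx.
  suff : 0 < Z x by rewrite Zx ltxx.
  rewrite /Z indicE (mem_set xr) mul1r lt_min ltr01 andbT /X mulr_gt0//.
    by rewrite /dtpow mulr_gt0 ?ltr0n// exprn_gt0// /clamp lt_min ltr01 andbT lt_max wx.
  by rewrite powR_gt0// lt_max wx.
pose B := n.+2%:R * C / (c / 2) ^+ K * 2 ^+ N.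
have c2 : 0 < c / 2 by rewrite divr_gt0.
have B0 : 0 <= B by rewrite !mulr_ge0 ?invr_ge0 ?exprn_ge0 ?ler0n// ltW.
(* [2 * r <= rho] puts the cube of half-side [r] where the cutoff is at least [k]; [1 <= rho] allows
   comparison of powers of [rho]. *)
have step (rho : R) : 1 <= rho -> 2 * r <= rho -> c / 2 * k * \int[mu]_x Z x <= B / rho.
  move=> rho1 rhor; have rho0 : 0 < rho by exact: lt_le_trans rho1.
  have [phi [phiA phi0 phirho phik lphi]] := H rho rho0.
  (* The extra unit is the room [kato] needs for its mollifiers. *)
  pose W := w \_ (cbox (rho + 1)); pose G := g \_ (cbox (rho + 1)).
  have KT := @kato R N n W G phi rho (wL _) (gL _) phiA phi0 phirho
    (fun f fA fr => localized_eqn fA fr).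
  have mW := integrable_measurable (wL (rho + 1)).
  have i1 : L1 (fun x => G x * dtpow n (W x) * phi x).
    by apply: L1_flat_alg => //; apply: L1_dtpow => //; exact: gL.
  have i2 : L1 (fun x => tpow n (W x) * laplacian phi x).
    by apply: L1_flat_alg; [apply: L1_tpow; exact: wL|exact: flat_alg_laplacian].
  pose D := C * rho^-1 ^+ (2 * K.+1).
  have D0 : 0 <= D by rewrite mulr_ge0// exprn_ge0// invr_ge0 ltW.
  pose E := n.+2%:R * D / (c / 2) ^+ K.
  have i3 : L1 (fun x => E * \1_(cbox rho) x) by exact: L1_cbox.
  have i12 := integrable_sub i1 i2.
  have : c / 2 * k * \int[mu]_x Z x <= \int[mu]_x (G x * dtpow n (W x) * phi x
      - tpow n (W x) * laplacian phi x + E * \1_(cbox rho) x).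
    rewrite -(RintegralZl _ measurableT Zi); apply: le_Rintegral => //.
    - exact: integrable_scale.
    - exact: integrable_add.
    move=> x _; have [xrho|xrho] := pselect (cbox rho x).
    - have xrho1 : x \in cbox (rho + 1).
        by rewrite inE => i; apply: le_trans (xrho i) _; rewrite lerDl.
      rewrite /W /G !patchE xrho1 indicE (mem_set xrho) mulr1.
      have PB := pointwise_bound x hn hK (phi0 x) D0 (lphi x).
      rewrite -/E in PB; apply: le_trans PB.
      rewrite -mulrA ler_wpM2l ?(ltW c2)// -/(X x) /Z indicE.
      case: (boolP (x \in cbox r)) => [|_]; last by rewrite mul0r mulr0 mulr_ge0.
      rewrite inE mul1r mulrC => xr; rewrite ler_pM ?(ltW k0) ?ge_min ?lexx//.
        by rewrite le_min X0 ler01.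
      by apply: phik => i; apply: le_trans (xr i) _; lra.
    - have [i /negP] : exists i, ~ `|x ord0 i| <= rho by apply/existsNP.
      rewrite -ltNge => xi.
      rewrite (phirho x i xi) (box_supported_laplacian phirho xi).
      rewrite /Z !indicE !memNset ?mul0r ?mulr0 ?subr0 ?addr0 ?mulr0// => /(_ i) xr.
      by have := lt_le_trans xi xr; lra.
  rewrite (RintegralD measurableT i12 i3) (RintegralB measurableT i1 i2) (Rintegral_cbox _ (ltW rho0)).
  suff : E * (2 * rho) ^+ N <= B / rho by lra.
  rewrite /E /D /B [(2 * rho) ^+ N]exprMn.
  have -> : n.+2%:R * (C * rho^-1 ^+ (2 * K.+1)) / (c / 2) ^+ K * (2 ^+ N * rho ^+ N)
    = n.+2%:R * C / (c / 2) ^+ K * 2 ^+ N * (rho^-1 ^+ (2 * K.+1) * rho ^+ N) by ring.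
  apply: ler_wpM2l => //.
  (* One factor [rho^-1] is set aside; the remaining [rho^-(2K+1)] compensates the volume [rho^N],
     as [N <= 2K + 1]. *)
  rewrite mulnS add2n.
  rewrite exprS -mulrA ler_piMr ?invr_ge0 ?(ltW rho0)//.
  by rewrite exprVn mulrC ler_pdivrMr ?exprn_gt0// mul1r ler_weXn2l.
apply/ler_addgt0Pr => e e0; rewrite add0r.
have ck : 0 < c / 2 * k by rewrite mulr_gt0.
pose rho := Num.max 1 (Num.max (2 * r) (B / (c / 2 * k * e))).
have rho1 : 1 <= rho by rewrite le_max lexx.
have rho0 : 0 < rho by exact: lt_le_trans rho1.
have := step rho rho1; rewrite !le_max lexx orbT => /(_ isT) S.
rewrite -(ler_pM2l ck); apply: le_trans S _.
by rewrite ler_pdivrMr// mulrC -ler_pdivrMr ?mulr_gt0// /rho !le_max lexx !orbT.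
Qed.

Lemma liouville : {ae mu, forall x, w x <= 0}.
Proof.
(* The first summand beats the volume growth; the second gives [K >= 1 / (theta - 1)], that is
   [1 + 1/K <= theta]. *)
pose K := (N + Num.bound (theta - 1)^-1)%N.
pose n := Num.bound ((theta - 1) * K%:R).
have hN : (N <= (2 * K).+1)%N by rewrite /K; lia.
have t0 : 0 < theta - 1 by rewrite subr_gt0.
have K1 : (theta - 1)^-1 <= K%:R.
  by rewrite /K natrD ler_wpDl ?ler0n// ltW// archi_boundP// invr_ge0 ltW.
have hK : K.+1%:R <= theta * K%:R.
  move: K1; rewrite -[_^-1]mul1r ler_pdivrMr// -natr1; lra.
have hn : (theta - 1) * K%:R <= n.+2%:R.
  apply: (@le_trans _ _ n%:R); last by rewrite ler_nat; lia.
  by rewrite ltW// archi_boundP// mulr_ge0 ?ler0n ?ltW.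
have H (r : nat) : {ae mu, forall x, cbox r.+1%:R x -> w x <= 0}.
  exact: liouville_cbox (ltr0Sn R r) hN hn hK.
have := ae_foralln H; apply: filterS => x Hx.
pose M := Num.bound (\sum_i `|x ord0 i|).
apply: (Hx M) => i; apply: ltW; apply: (@le_lt_trans _ _ (\sum_i `|x ord0 i|)).
  by rewrite (bigD1 i)//= lerDl sumr_ge0.
apply: lt_trans (archi_boundP _) _; first by rewrite sumr_ge0.
by rewrite ltr_nat.
Qed.

End liouville.

(** * Signed powers and local integrability *)


Section signed_power.
Context {R : realType}.
Implicit Types (a b e t : R).

(** The odd extension of the power; the factor [t] forces the value 0 at 0, whatever the convention
    for a power of 0. *)
Definition spow e t := `|t| `^ (e - 1) * t.

Lemma spow_ge0E e t : 0 < e -> 0 <= t -> spow e t = t `^ e.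
Proof. by move=> e0 t0; rewrite /spow ger0_norm// mulrC mulr_powRB1. Qed.

Lemma spowN e t : spow e (- t) = - spow e t.
Proof. by rewrite /spow normrN mulrN. Qed.

Lemma norm_spow e t : 0 < e -> `|spow e t| = `|t| `^ e.
Proof.
by move=> e0; rewrite /spow normrM ger0_norm ?powR_ge0// mulrC mulr_powRB1.
Qed.

Lemma spow_ge0 e t : 0 <= t -> 0 <= spow e t.
Proof. by move=> t0; rewrite mulr_ge0 ?powR_ge0. Qed.

Lemma spow_le0 e t : t <= 0 -> spow e t <= 0.
Proof. by move=> t0; rewrite mulr_ge0_le0 ?powR_ge0. Qed.

Lemma spow_nondecreasing e a b : 0 < e -> a <= b -> spow e a <= spow e b.
Proof.
move=> e0 ab.
have H x y : 0 <= x -> x <= y -> spow e x <= spow e y.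
  move=> x0 xy; rewrite !spow_ge0E ?(le_trans x0)//.
  by apply: ge0_ler_powR; rewrite ?nnegrE ?(ltW e0) ?(le_trans x0).
case: (leP 0 a) => a0; first exact: H.
case: (leP 0 b) => b0.
  by apply: le_trans (spow_ge0 e b0); apply: spow_le0; exact: ltW.
by rewrite -lerN2 -!spowN; apply: H; rewrite ?lerN2// oppr_ge0 ltW.
Qed.

Lemma spow_superadditive e a b : 1 < e -> 0 <= a -> 0 <= b ->
  a `^ e + b `^ e <= (a + b) `^ e.
Proof.
move=> e1 a0 b0; have e0 : 0 < e by lra.
rewrite -(mulr_powRB1 a0 e0) -(mulr_powRB1 b0 e0) -(mulr_powRB1 (addr_ge0 a0 b0) e0).
rewrite mulrDl lerD//; apply: ler_wpM2l => //; apply: ge0_ler_powR;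
  rewrite ?nnegrE; lra.
Qed.

(** Either [a] or [- b] is at least [(a - b) / 2], and oddness reduces the second case to the first.
    If [b <= 0], dropping [- spow e b] suffices, at the price of the factor [1 / 2]; if [b > 0],
    superadditivity gives more. *)
Lemma spow_strongly_monotone e a b : 1 < e -> b < a ->
  ((a - b) / 2) `^ e <= spow e a - spow e b.
Proof.
move=> e1 ba; have e0 : 0 < e by lra.
have H x y : y < x -> (x - y) / 2 <= x -> ((x - y) / 2) `^ e <= spow e x - spow e y.
  move=> yx xy; have d0 : 0 <= (x - y) / 2 by lra.
  have x0 : 0 <= x by exact: le_trans xy.
  case: (leP y 0) => y0.
    have := spow_le0 e y0; rewrite (spow_ge0E e0 x0).
    have : ((x - y) / 2) `^ e <= x `^ e by apply: ge0_ler_powR; rewrite ?nnegrE; lra.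
    lra.
  have xy0 : 0 <= x - y by lra.
  have := spow_superadditive e1 xy0 (ltW y0); rewrite subrK.
  rewrite (spow_ge0E e0 x0) (spow_ge0E e0 (ltW y0)).
  have : ((x - y) / 2) `^ e <= (x - y) `^ e by apply: ge0_ler_powR; rewrite ?nnegrE; lra.
  lra.
case: (leP ((a - b) / 2) a) => ab; first exact: H.
have := H (- b) (- a); rewrite !spowN !opprK (addrC (- b)) ltrN2 => /(_ ba).
by rewrite (addrC (- spow e b)); apply; lra.
Qed.

(** This extracts from each coupling term the factor [|t|^s] that makes the two equations share
    [|u|^s |v|^s]. The value [t = 0] is separate because the addition rule for exponents can fail at
    base 0. *)
Lemma spowD s e t : 0 < e -> `|t| `^ (s + e - 1) * t = `|t| `^ s * spow e t.
Proof.
move=> e0; have [->|t0] := eqVneq t 0; first by rewrite /spow !mulr0.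
by rewrite /spow mulrA -powRD ?addrA// normr_eq0 t0 implybT.
Qed.

Lemma powR_le1D a e p : 0 <= a -> 0 <= e <= p -> a `^ e <= 1 + a `^ p.
Proof.
move=> a0 /andP[e0 ep]; case: (leP a 1) => a1.
  apply: (@le_trans _ _ 1); last by rewrite lerDl powR_ge0.
  rewrite -[leRHS](congr1 (fun f => f e) (@powR1 R)).
  by apply: ge0_ler_powR; rewrite ?nnegrE.
apply: (@le_trans _ _ (a `^ p)); last by rewrite lerDr.
by apply: ler_powR; rewrite ?(ltW a1).
Qed.

End signed_power.

Section local_integrability.
Context {R : realType} {N : nat}.
Notation mu := (@lebesgue_rV R N).
Notation L1 f := (mu.-integrable setT (EFin \o f)).
Implicit Types (f u v a : 'rV[R]_N -> R).

(** The sigma-algebra is generated by the coordinates, so an open set is written as a countable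
    union of boxes with rational centre and radius [1 / (k + 1)]. *)
Lemma open_measurable_rV (U : set 'rV[R]_N) : open U -> measurable U.
Proof.
move=> oU.
pose box (q : 'rV[rat]_N * nat) : set 'rV[R]_N :=
  \bigcap_(i : 'I_N) (coord_rV i @^-1` ball (ratr (q.1 ord0 i) : R) (q.2.+1%:R^-1)).
have mbox q : measurable (box q).
  apply: fin_bigcap_measurable => // i _.
  rewrite -[X in measurable X]setTI; apply: measurable_coord_rV => //.
  by apply: open_measurable; exact: ball_open.
rewrite (_ : U = \bigcup_(q in [set q | box q `<=` U]) box q); last first.
  apply/seteqP; split => [x Ux|x [q /= qU qx]]; last exact: qU.
  have /nbhs_ballP[e /= e0 eU] : nbhs x U by exact: open_nbhs_nbhs.
  (* Half the radius: a point of the box is compared with the rational centre, then the centre with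
     [x]. *)
  have e20 : 0 < e / 2 by rewrite divr_gt0.
  have [k _ /(_ k (leqnn _)) /= ke] := near_infty_natSinv_lt (PosNum e20).
  have k0 : 0 < k.+1%:R^-1 :> R by rewrite invr_gt0.
  have /boolp.choice[q qP] : forall i, exists q : rat, `|ratr q - x ord0 i| < k.+1%:R^-1.
    move=> i; have : x ord0 i - k.+1%:R^-1 < x ord0 i + k.+1%:R^-1.
      by rewrite ltrBlDr -addrA ltrDl addr_gt0.
    by move=> /rat_in_itvoo[q]; rewrite in_itv/= -ltr_distl => qx; exists q.
  have qE i : `|ratr ((\row_i q i) ord0 i) - x ord0 i| < k.+1%:R^-1 by rewrite mxE.
  exists (\row_i q i, k); last by move=> i _; exact: qE.
  move=> z zq; apply: eU; split => // i j; rewrite (ord1 i).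
  have := zq j Logic.I; rewrite /= /ball/= /coord_rV => zj.
  have qj := qE j; rewrite distrC in qj.
  have := ler_distD (ratr ((\row_i q i) ord0 j)) (x ord0 j) (z ord0 j).
  by move: zj qj ke; move: (k.+1%:R^-1) => d; rewrite /ball/=; lra.
rewrite bigcup_mkcond; apply: countable_bigcupT_measurable; first exact: countableP.
by move=> q; case: ifP.
Qed.

Lemma continuous_measurable_rV a : continuous a -> measurable_fun setT a.
Proof.
move=> /continuousP ca; apply: (measurability _ (RGenOpens.measurableE R)).
move=> _ [_ [x [y ->] <-]]; rewrite setTI; apply: open_measurable_rV.
exact/ca/interval_open.
Qed.

Lemma continuous_cbox_bounded a r : continuous a ->
  exists C, forall x, cbox r x -> `|a x| <= C.
Proof.
move=> ca; have cK := @cbox_compact R N r.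
have [M [_ aM]] := compact_bounded (continuous_compact (continuous_subspaceT ca) cK).
by exists (M + 1) => x xr; apply: (aM (M + 1)); [rewrite ltrDl|exists x].
Qed.

Lemma L1_cbox_dominated p u v f C r : Lp_loc p u -> Lp_loc p v ->
  measurable_fun setT f ->
  (forall x, cbox r x -> `|f x| <= C * (2 + `|u x| `^ p + `|v x| `^ p)) ->
  L1 (f \_ (cbox r)).
Proof.
move=> [mu_ ui] [mv vi] mf fC.
have mpow (h : 'rV[R]_N -> R) : measurable_fun setT h -> measurable_fun setT (fun x => `|h x| `^ p).
  move=> mh; have mn : measurable_fun setT (fun x => `|h x|) by exact: measurableT_comp.
  by have := measurableT_comp (@measurable_powR R p) mn.
have powL (h : 'rV[R]_N -> R) : measurable_fun setT h ->
    (\int[mu]_(x in cbox r) (`|h x| `^ p)%:E < +oo)%E ->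
    L1 ((fun x => `|h x| `^ p) \_ (cbox r)).
  move=> mh hi; apply: integrable_patch; first exact: measurable_cbox.
  apply/integrableP; split; first by apply/measurable_EFinP/measurable_funTS; exact: mpow.
  by under eq_integral do rewrite gee0_abs ?lee_fin ?powR_ge0//.
have iu := powL u mu_ (ui _ (@cbox_compact R N r)).
have iv := powL v mv (vi _ (@cbox_compact R N r)).
apply: (integrable_dominated (g := fun x => C * (2 * \1_(cbox r) x + ((fun x => `|u x| `^ p) \_ (cbox r)) x
   + ((fun x => `|v x| `^ p) \_ (cbox r)) x))).
- by apply: measurable_patch => //; exact: measurable_cbox.
- move=> x; rewrite !patchE indicE; case: ifPn; last by rewrite normr0 !mulr0 !addr0 mulr0.
  by rewrite inE mulr1; exact: fC.
- by apply: integrable_scale; apply: integrable_add => //; apply: integrable_add => //; exact: L1_cbox.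
Qed.

End local_integrability.

(** * Comparison of the two components of a solution *)

Section comparison.
Context {R : realType} {N : nat}.
Notation mu := (@lebesgue_rV R N).
Notation L1 f := (mu.-integrable setT (EFin \o f)).
Variables (alpha beta lambda : 'rV[R]_N -> R) (m theta s gamma lambda0 : R).
Hypotheses (alpha_cont : continuous alpha) (beta_cont : continuous beta)
  (lambda_cont : continuous lambda).
Hypotheses (hm : 0 < m) (htheta : 1 < theta) (hs : 0 <= s) (hgamma : 1 <= gamma).
Hypotheses (alpha_ge0 : forall x, 0 <= alpha x) (beta_ge0 : forall x, 0 <= beta x)
  (hlambda0 : 0 < lambda0) (lambda_ge : forall x, lambda0 <= lambda x).
Variables u v : 'rV[R]_N -> R.
Let p := Num.max m (Num.max theta (2 * s + gamma)).
Hypotheses (hu : Lp_loc p u) (hv : Lp_loc p v).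
Hypothesis huv : distr_solution alpha beta lambda m theta s gamma u v.

Let mle : 0 <= m <= p. Proof. by rewrite ltW//= le_max lexx. Qed.
Let thetale : 0 <= theta <= p.
Proof. by apply/andP; split; [move: htheta; lra|rewrite /p !le_max lexx /= orbT]. Qed.
Let sgle : 0 <= 2 * s + gamma <= p.
Proof. by apply/andP; split; [move: hs hgamma; lra|rewrite /p !le_max lexx /= !orbT]. Qed.
Let onele : 0 <= (1 : R) <= p.
Proof. by have /andP[_] := thetale; rewrite ler01/=; move: htheta; lra. Qed.

Let mu_ : measurable_fun setT u. Proof. by case: hu. Qed.
Let mv_ : measurable_fun setT v. Proof. by case: hv. Qed.

Lemma measurable_spow e (w : 'rV[R]_N -> R) : measurable_fun setT w ->
  measurable_fun setT (fun x => spow e (w x)).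
Proof.
move=> mw; have mn : measurable_fun setT (fun x => `|w x|) by exact: measurableT_comp.
by apply: measurable_funM => //; have := measurableT_comp (@measurable_powR R (e - 1)) mn.
Qed.

Lemma L1_coef_spow (a w : 'rV[R]_N -> R) e r : continuous a -> 0 < e -> 0 <= e <= p ->
  Lp_loc p w -> L1 ((fun x => a x * spow e (w x)) \_ (cbox r)).
Proof.
move=> ca e0 ep hw; have [C aC] := continuous_cbox_bounded r ca.
apply: (L1_cbox_dominated (C := `|C|) hw hw).
  by apply: measurable_funM; [exact: continuous_measurable_rV|apply: measurable_spow; case: hw].
move=> x xr; rewrite normrM norm_spow// ler_pM ?powR_ge0//.
  exact: le_trans (aC x xr) (ler_norm _).
have := powR_le1D (normr_ge0 (w x)) ep; have := powR_ge0 `|w x| p; lra.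
Qed.

Lemma L1_unknown (w : 'rV[R]_N -> R) r : Lp_loc p w -> L1 (w \_ (cbox r)).
Proof.
move=> hw; have c1 : continuous ((fun=> 1) : 'rV[R]_N -> R) by move=> x; exact: cst_continuous.
have := L1_coef_spow r c1 ltr01 onele hw.
by under [X in X \_ _]eq_fun do rewrite mul1r /spow subrr powRr0 mul1r.
Qed.

(** With [M] the larger of [|w|] and [|z|], the product is at most [M^s M^(s + gamma)]: this is
    where the exponent [2 * s + gamma] in [p] comes from. *)
Lemma L1_coupling (w z : 'rV[R]_N -> R) r : Lp_loc p w -> Lp_loc p z ->
  L1 ((fun x => beta x * `|w x| `^ s * (`|z x| `^ (s + gamma - 1) * z x)) \_ (cbox r)).
Proof.
move=> hw hz; have [C bC] := continuous_cbox_bounded r beta_cont.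
have [mw _] := hw; have [mz _] := hz.
have sg0 : 0 < s + gamma by move: hs hgamma; lra.
apply: (L1_cbox_dominated (C := `|C|) hw hz).
  have mn : measurable_fun setT (fun x => `|w x|) by exact: measurableT_comp.
  apply: measurable_funM; last exact: measurable_spow.
  apply: measurable_funM; first exact: continuous_measurable_rV.
  by have := measurableT_comp (@measurable_powR R s) mn.
move=> x xr; rewrite !normrM -mulrA ler_pM ?mulr_ge0//.
  exact: le_trans (bC x xr) (ler_norm _).
rewrite -normrM (norm_spow _ sg0) (ger0_norm (powR_ge0 _ _)).
pose M := Num.max `|w x| `|z x|.
have M0 : 0 <= M by rewrite le_max normr_ge0.
have h1 : `|w x| `^ s <= M `^ s by apply: ge0_ler_powR; rewrite ?nnegrE// le_max lexx.
have h2 : `|z x| `^ (s + gamma) <= M `^ (s + gamma).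
  by apply: ge0_ler_powR; rewrite ?nnegrE ?(ltW sg0)// le_max lexx orbT.
apply: (@le_trans _ _ (M `^ (2 * s + gamma))).
  have -> : M `^ (2 * s + gamma) = M `^ s * M `^ (s + gamma).
    rewrite -powRD; last by rewrite gt_eqF//; move: hs hgamma; lra.
    by congr (_ `^ _); ring.
  by rewrite ler_pM ?powR_ge0.
apply: le_trans (powR_le1D M0 sgle) _.
have := powR_ge0 `|w x| p; have := powR_ge0 `|z x| p.
by rewrite /M; case: (leP `|w x| `|z x|) => _; lra.
Qed.

(** Signs are arranged so that the equation for [w] reads [Delta w = source w z]. *)
Let source (w z : 'rV[R]_N -> R) x := alpha x * spow m (w x) + lambda x * spow theta (w x)
  - beta x * `|w x| `^ s * (`|z x| `^ (s + gamma - 1) * z x).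

Lemma L1_source w z r : Lp_loc p w -> Lp_loc p z -> L1 ((source w z) \_ (cbox r)).
Proof.
move=> hw hz.
have -> : (source w z) \_ (cbox r) = fun x =>
    ((fun x => alpha x * spow m (w x)) \_ (cbox r)) x
    + ((fun x => lambda x * spow theta (w x)) \_ (cbox r)) x
    - ((fun x => beta x * `|w x| `^ s * (`|z x| `^ (s + gamma - 1) * z x)) \_ (cbox r)) x.
  by apply/funext => x; rewrite !patchE; case: ifP => //; rewrite addr0 subr0.
apply: integrable_sub; last exact: L1_coupling.
apply: integrable_add; apply: L1_coef_spow => //; move: htheta; lra.
Qed.

Lemma L1_test (w f : 'rV[R]_N -> R) r : L1 (w \_ (cbox r)) -> flat_alg f ->
  box_supported r f -> L1 (fun x => w x * f x).
Proof.
move=> wi fA fr; have := L1_flat_alg wi fA.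
congr (mu.-integrable setT _); apply/funext => x /=; rewrite patchE; case: ifPn => //.
rewrite notin_setE => /existsNP[i /negP]; rewrite -ltNge => /fr ->.
by rewrite !mulr0.
Qed.

Let rearrange (a b c d : R) : - a + b = - c + d -> a = b + c - d.
Proof. by lra. Qed.

(** The definition tests each term by its own integral; merging them into one requires each term to
    be integrable against [f], which local integrability and the support of [f] provide. *)
Lemma distr_equation_source w z f r : Lp_loc p w -> Lp_loc p z ->
  distr_equation alpha beta lambda m theta s gamma w z ->
  flat_alg f -> box_supported r f ->
  \int[mu]_x (w x * laplacian f x) = \int[mu]_x (source w z x * f x).
Proof.
move=> hw hz eq fA fr; have := eq f (flat_alg_test fA fr).
rewrite /distr_laplacian /regular_distr => E.
have i1 : L1 (fun x => alpha x * spow m (w x) * f x).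
  by apply: (L1_test (r := r)) => //; exact: L1_coef_spow.
have i2 : L1 (fun x => lambda x * spow theta (w x) * f x).
  by apply: (L1_test (r := r)) => //; apply: L1_coef_spow => //; move: htheta; lra.
have i3 : L1 (fun x => beta x * `|w x| `^ s * (`|z x| `^ (s + gamma - 1) * z x) * f x).
  by apply: (L1_test (r := r)) => //; exact: L1_coupling.
transitivity (\int[mu]_x (alpha x * spow m (w x) * f x + lambda x * spow theta (w x) * f x
   - beta x * `|w x| `^ s * (`|z x| `^ (s + gamma - 1) * z x) * f x)); last first.
  by apply: eq_Rintegral => x _; rewrite /source; ring.
rewrite (RintegralB measurableT (integrable_add i1 i2) i3) (RintegralD measurableT i1 i2).
have e1 : \int[mu]_x (alpha x * `|w x| `^ (m - 1) * w x * f x) = \int[mu]_x (alpha x * spow m (w x) * f x).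
  by apply: eq_Rintegral => x _; rewrite /spow; ring.
have e2 : \int[mu]_x (lambda x * `|w x| `^ (theta - 1) * w x * f x) = \int[mu]_x (lambda x * spow theta (w x) * f x).
  by apply: eq_Rintegral => x _; rewrite /spow; ring.
have e3 : \int[mu]_x (beta x * `|w x| `^ s * `|z x| `^ (s + gamma - 1) * z x * f x)
    = \int[mu]_x (beta x * `|w x| `^ s * (`|z x| `^ (s + gamma - 1) * z x) * f x).
  by apply: eq_Rintegral => x _; ring.
rewrite e1 e2 e3 in E; exact: rearrange E.
Qed.

(** The absorption in [alpha] and the coupling, after [spowD], contribute nonnegative terms that are
    dropped. The bound comes from the [lambda] term alone, with [2^-1] raised to [theta] inherited
    from [spow_strongly_monotone]. *)
Lemma source_gap x : v x < u x ->
  lambda0 * 2^-1 `^ theta * (u x - v x) `^ theta <= source u v x - source v u x.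
Proof.
move=> vu; have g0 : 0 < gamma by move: hgamma; lra.
have a1 : 0 <= alpha x * (spow m (u x) - spow m (v x)).
  by rewrite mulr_ge0// subr_ge0 spow_nondecreasing// ltW.
have b1 : 0 <= beta x * (`|u x| `^ s * `|v x| `^ s) * (spow gamma (u x) - spow gamma (v x)).
  by rewrite !mulr_ge0 ?powR_ge0// subr_ge0 spow_nondecreasing// ltW.
have l1 : lambda0 * ((u x - v x) / 2) `^ theta <= lambda x * (spow theta (u x) - spow theta (v x)).
  by rewrite ler_pM ?powR_ge0 ?spow_strongly_monotone// ltW.
have uv0 : 0 <= u x - v x by lra.
rewrite powRM ?invr_ge0// in l1.
rewrite /source (spowD s (v x) g0) (spowD s (u x) g0).
have -> : alpha x * spow m (u x) + lambda x * spow theta (u x) -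
  beta x * `|u x| `^ s * (`|v x| `^ s * spow gamma (v x)) -
  (alpha x * spow m (v x) + lambda x * spow theta (v x) -
   beta x * `|v x| `^ s * (`|u x| `^ s * spow gamma (u x))) =
  alpha x * (spow m (u x) - spow m (v x)) + lambda x * (spow theta (u x) - spow theta (v x))
  + beta x * (`|u x| `^ s * `|v x| `^ s) * (spow gamma (u x) - spow gamma (v x)) by ring.
lra.
Qed.

Lemma solution_le : {ae mu, forall x, u x <= v x}.
Proof.
have [eu ev] := huv.
have c0 : 0 < lambda0 * 2^-1 `^ theta by rewrite mulr_gt0// powR_gt0.
have := @liouville R N theta (lambda0 * 2^-1 `^ theta) (fun x => u x - v x)
  (fun x => source u v x - source v u x) htheta c0.
have patchB (f g : 'rV[R]_N -> R) r : (fun x => f x - g x) \_ (cbox r) = fun x => (f \_ (cbox r)) x - (g \_ (cbox r)) x.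
  by apply/funext => x; rewrite !patchE; case: ifP => //; rewrite subr0.
move=> L; have {L} : {ae mu, forall x, u x - v x <= 0}.
  apply: L.
  - exact: measurable_funB.
  - by move=> r; rewrite patchB; apply: integrable_sub; exact: L1_unknown.
  - by move=> r; rewrite patchB; apply: integrable_sub; exact: L1_source.
  - move=> f r fA fr.
    have lA := flat_alg_laplacian fA; have lr := box_supported_laplacian fr.
    have i1 := L1_test (L1_unknown r hu) lA lr.
    have i2 := L1_test (L1_unknown r hv) lA lr.
    have i3 := L1_test (L1_source r hu hv) fA fr.
    have i4 := L1_test (L1_source r hv hu) fA fr.
    under eq_Rintegral do rewrite mulrBl.
    rewrite (RintegralB measurableT i1 i2).
    rewrite (distr_equation_source hu hv eu fA fr) (distr_equation_source hv hu ev fA fr).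
    rewrite -(RintegralB measurableT i3 i4); apply: eq_Rintegral => x _.
    by rewrite [RHS]mulrBl.
  - by move=> x; rewrite subr_gt0; exact: source_gap.
by apply: filterS => x; rewrite subr_le0.
Qed.

End comparison.

Theorem theorem2p1 (R : realType) (N : nat) (hN : (1 <= N)%N)
  (alpha beta lambda : 'rV[R]_N -> R)
  (alpha_cont : continuous alpha) (beta_cont : continuous beta)
  (lambda_cont : continuous lambda)
  (m theta s gamma lambda0 : R)
  (hm : 0 < m) (htheta : 1 < theta) (hs : 0 <= s) (hgamma : 1 <= gamma)
  (alpha_ge0 : forall x, 0 <= alpha x) (beta_ge0 : forall x, 0 <= beta x)
  (hlambda0 : 0 < lambda0) (lambda_ge : forall x, lambda0 <= lambda x)
  (u v : 'rV[R]_N -> R)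
  (hu : Lp_loc (Num.max m (Num.max theta (2 * s + gamma))) u)
  (hv : Lp_loc (Num.max m (Num.max theta (2 * s + gamma))) v)
  (huv : distr_solution alpha beta lambda m theta s gamma u v) :
  {ae lebesgue_rV N, forall x, u x = v x}.
Proof.
have le w z : Lp_loc (Num.max m (Num.max theta (2 * s + gamma))) w ->
    Lp_loc (Num.max m (Num.max theta (2 * s + gamma))) z ->
    distr_solution alpha beta lambda m theta s gamma w z ->
    {ae lebesgue_rV N, forall x, w x <= z x}.
  move=> hw hz hwz.
  by have := solution_le alpha_cont beta_cont lambda_cont hm htheta hs hgamma
    alpha_ge0 beta_ge0 hlambda0 lambda_ge hw hz hwz.
have vu : distr_solution alpha beta lambda m theta s gamma v u by case: huv.
by apply: filterS2 (le _ _ hu hv huv) (le _ _ hv hu vu) => x uvx vux;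
  apply/eqP; rewrite eq_le uvx.
Qed.
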